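(* Let $\Gamma$ be a connected graph such that for every vertex $u$ the subgraph induced on the neighbourhood of $u$ is isomorphic to the collinearity graph of a generalized quadrangle of order $(3,3)$ (i.e. to the collinearity graph of $W(3)$ or of $Q_4(3)$). Then $\Gamma\cong\mathcal{U}_5$.
   Context: $W(3)$ is the generalized quadrangle of points of $PG(3,3)$ and lines totally isotropic for a nondegenerate symplectic form; $Q_4(3)$ is the generalized quadrangle of singular points and lines of $PG(4,3)$ for a nondegenerate quadratic form. These are the only two generalized quadrangles of order $(3,3)$. For $n\ge1$, $\mathcal{U}_n$ is the graph whose vertices are the nonisotropic points of an $n$-dimensional $\mathrm{GF}(4)$-vector space carrying a nondegenerate hermitian form, two vertices being adjacent iff they are perpendicular. *)

(* Defs.v *)
From HB Require Import structures.
From mathcomp Require Import all_boot all_order all_algebra all_field.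
From Stdlib Require Import Relations.
Set Implicit Arguments. Unset Strict Implicit. Unset Printing Implicit Defensive.
Import GRing.Theory.
Local Open Scope ring_scope.

Definition connected_graph (V : Type) (adj : V -> V -> Prop) : Prop :=
  inhabited V /\ forall x y : V, clos_refl_trans V adj x y.

Definition iso_on (V1 V2 : Type) (A1 : V1 -> V1 -> Prop) (S1 : V1 -> Prop)
    (A2 : V2 -> V2 -> Prop) (S2 : V2 -> Prop) : Prop :=
  exists f : V1 -> V2,
    [/\ (forall x, S1 x -> S2 (f x)),
        (forall x y, S1 x -> S1 y -> f x = f y -> x = y),
        (forall y, S2 y -> exists2 x, S1 x & f x = y)
      & (forall x y, S1 x -> S1 y -> (A1 x y <-> A2 (f x) (f y)))].

(** each point of PG(n-1,F) is represented by its unique normalized vector: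
    the first nonzero coordinate equals 1 *)
Definition normalized (F : fieldType) (n : nat) (v : 'rV[F]_n) : bool :=
  [exists i : 'I_n, (v ord0 i == 1) && [forall j : 'I_n, (j < i)%N ==> (v ord0 j == 0)]].

Definition crd (F : fieldType) (m : nat) (v : 'rV[F]_m.+1) (k : nat) : F :=
  v ord0 (inord k).

(* ---------- W(3): points of PG(3,3), totally isotropic lines of a
   nondegenerate symplectic form ---------- *)

Definition symp (x y : 'rV['F_3]_4) : 'F_3 :=
  crd x 0 * crd y 1 - crd x 1 * crd y 0 + crd x 2 * crd y 3 - crd x 3 * crd y 2.

Definition W3pt (v : 'rV['F_3]_4) : Prop := normalized v.
(** collinearity graph: distinct points on a common (totally isotropic) line *)
Definition W3adj (x y : 'rV['F_3]_4) : Prop := x <> y /\ symp x y = 0.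

(* ---------- Q_4(3): singular points / lines of a nondegenerate quadratic
   form on PG(4,3) ---------- *)

Definition quad (x : 'rV['F_3]_5) : 'F_3 :=
  crd x 0 * crd x 1 + crd x 2 * crd x 3 + crd x 4 ^+ 2.

Definition quadB (x y : 'rV['F_3]_5) : 'F_3 := quad (x + y) - quad x - quad y.

Definition Q43pt (v : 'rV['F_3]_5) : Prop := normalized v /\ quad v = 0.
(** distinct singular points are collinear iff the joining line is totally
    singular iff they are orthogonal for the polar form *)
Definition Q43adj (x y : 'rV['F_3]_5) : Prop := x <> y /\ quadB x y = 0.

(* ---------- U_n over a field F of order 4, hermitian form
   h(x,y) = sum_i x_i * conj(y_i), conj a = a^2 ---------- *)

Definition herm (F : finFieldType) (n : nat) (x y : 'rV[F]_n) : F :=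
  \sum_(i < n) x ord0 i * (y ord0 i) ^+ 2.

Definition Upt (F : finFieldType) (n : nat) (v : 'rV[F]_n) : Prop :=
  normalized v /\ herm v v != 0.
Definition Uadj (F : finFieldType) (n : nat) (x y : 'rV[F]_n) : Prop :=
  x <> y /\ herm x y = 0.

(* Main.v *)
Require Import Defs.
From HB Require Import structures.
From mathcomp Require Import all_boot all_order all_algebra all_field.
From mathcomp Require Import ring.
From Stdlib Require List.
From Stdlib Require Import ClassicalEpsilon.
Set Implicit Arguments. Unset Strict Implicit. Unset Printing Implicit Defensive.
Import GRing.Theory.

(** Write Γ(u) for the neighbourhood of u. If u and v are at distance two, their
    common neighbours form a hyperoval of Γ(u): a set of points that every line
    meets in 0 or 2 points. W(3) and Q_4(3) have 1737 and 2385 hyperovals, and no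
    graph occurs in both lists, so all neighbourhoods have the same type.

    Inside Γ(w) one reads off that every path (resp. claw, for Q_4(3)) with centre
    w in Γ(u) lies in the hyperoval of some v, and in how many points two such
    hyperovals through w may agree around w. For Q_4(3) these conditions are
    contradictory; for W(3) they only leave the hyperovals of size 8, which are
    complete bipartite graphs K_{4,4}.

    Then Γ contains a complete tripartite graph A, B, L with parts of size 4, and
    each triple (A_i, B_j, L_k) lies in one 5-clique, whose other two vertices make
    up the cell (i, j, k). Two cells are joined by a perfect matching if they share
    exactly one index, and by no edge if they share none or two, so the graph on
    the 64 cells is a sign on each of 864 edges. Triangles and quadrangles of cells
    give linear relations over F_2 that determine the signs up to relabelling. The
    other 36 vertices are the fifth vertices of 4-cliques in the cells. So U_5 maps
    injectively into Γ, and the map is onto because both graphs have valency 40 and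
    Γ is connected. *)

(** The hyperoval argument rests on a change of centre. Let v, v' be at distance two from u, and let
    w be adjacent to u, v and v'. The common neighbours of u, v, v', w can be counted in Γ(u), as
    the points around w shared by two hyperovals, or in Γ(w), where u, v, v' are three points of a
    known quadrangle. There the answer is a matter of regularity: three pairwise noncollinear points
    have 1 or 4 common neighbours in W(3), and 0 or 2 in Q_4(3). After [K444_exists], the
    neighbourhoods enter only through [triangle_axiom], [gq_axiom], the K_{4,4} property,
    [parity_axiom] and the valency 40. The signs have two sources of freedom: exchanging the two
    vertices of a cell, which makes them agree with those of U_5 on a spanning tree, and permuting
    the indices of A, B, L, which accounts for two more binary choices. Nonadjacency among the last
    36 vertices, and between them and A, B, L, comes from counting: the 40 neighbours already found
    leave no room for others. *)

(* [andb] and [orb] are strict under call by value; these versions stop early. *)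
Section Lazy.
Variables (T : Type) (a : T -> bool).
Fixpoint lall (s : seq T) :=
  if s is x :: s' then if a x then lall s' else false else true.
Fixpoint lhas (s : seq T) :=
  if s is x :: s' then if a x then true else lhas s' else false.
Lemma lallE s : lall s = all a s.
Proof. by elim: s => //= x s ->; case: (a x). Qed.
Lemma lhasE s : lhas s = has a s.
Proof. by elim: s => //= x s ->; case: (a x). Qed.
End Lazy.

(** * Points, collinearity tables and lines of the two quadrangles *)

Lemma mem_iota40 i : (i \in iota 0 40) = (i < 40).
Proof. by rewrite mem_iota. Qed.

Definition all40 (P : nat -> bool) := lall P (iota 0 40).

Lemma all40P (P : nat -> bool) : reflect (forall i, i < 40 -> P i) (all40 P).
Proof.
rewrite /all40 lallE; apply: (iffP allP) => h i => [hi|].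
  by apply: h; rewrite mem_iota.
by rewrite mem_iota => /h.
Qed.

Fixpoint digits (b n k : nat) : seq nat :=
  if n is n'.+1 then rcons (digits b n' (k %/ b)) (k %% b) else [::].

(* The order of the points is chosen so that [enum_sets] below prunes early. *)
Definition ptsW : seq (seq nat) := Eval vm_compute in map (digits 3 4)
  [:: 46; 45; 1; 47; 39; 34; 17; 43; 12; 31; 50; 11; 48; 29; 37; 49; 32; 40; 27;
      5; 28; 52; 30; 38; 41; 36; 13; 51; 16; 33; 42; 3; 14; 44; 53; 10; 9; 4;
      15; 35].

Definition ptsQ : seq (seq nat) := Eval vm_compute in map (digits 3 5)
  [:: 143; 49; 99; 121; 30; 129; 159; 16; 147; 154; 45; 84; 146; 133; 139; 103;
      87; 122; 44; 134; 90; 155; 104; 140; 43; 81; 9; 137; 3; 97; 98; 36; 142;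
      17; 136; 27; 145; 33; 123; 50].

(** The factor 2 stands for -1 modulo 3; in [quadBn] it comes instead from polarising the square. *)
Definition sympn (x y : seq nat) : nat :=
  (nth 0 x 0 * nth 0 y 1 + 2 * (nth 0 x 1 * nth 0 y 0)
   + nth 0 x 2 * nth 0 y 3 + 2 * (nth 0 x 3 * nth 0 y 2)) %% 3.
Definition quadn (x : seq nat) : nat :=
  (nth 0 x 0 * nth 0 x 1 + nth 0 x 2 * nth 0 x 3 + nth 0 x 4 * nth 0 x 4) %% 3.
Definition quadBn (x y : seq nat) : nat :=
  (nth 0 x 0 * nth 0 y 1 + nth 0 x 1 * nth 0 y 0
   + nth 0 x 2 * nth 0 y 3 + nth 0 x 3 * nth 0 y 2
   + 2 * (nth 0 x 4 * nth 0 y 4)) %% 3.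

Definition mktable (f : seq nat -> seq nat -> nat) (pts : seq (seq nat)) :=
  [seq [seq (x != y) && (f x y == 0) | y <- pts] | x <- pts].

(** Stored as a literal so that later computations do not rebuild it; [TWE] and [TQE] tie the
    literals to the forms. *)
Definition TW : seq bitseq := Eval vm_compute in mktable sympn ptsW.
Definition TQ : seq bitseq := Eval vm_compute in mktable quadBn ptsQ.

Lemma TWE : mktable sympn ptsW = TW.
Proof. by vm_cast_no_check (erefl TW). Qed.
Lemma TQE : mktable quadBn ptsQ = TQ.
Proof. by vm_cast_no_check (erefl TQ). Qed.

Definition tadj (T : seq bitseq) i j := nth false (nth [::] T i) j.

Fixpoint cnt3 (a b c : bitseq) : nat :=
  match a, b, c with
  | x :: a', y :: b', z :: c' =>
      if x then if y then if z then (cnt3 a' b' c').+1 else cnt3 a' b' c'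
                else cnt3 a' b' c' else cnt3 a' b' c'
  | _, _, _ => 0
  end.

Lemma cnt3E n a b c : size a = n -> size b = n -> size c = n ->
  cnt3 a b c =
  count (fun i => [&& nth false a i, nth false b i & nth false c i]) (iota 0 n).
Proof.
elim: n a b c => [|n IH] [|x a] [|y b] [|z c] //= [sa] [sb] [sc].
rewrite (iotaDl 1 0 n) count_map.
by rewrite (IH a b c) //; case: x; case: y; case: z.
Qed.

(** Pairwise collinear points of a generalized quadrangle lie on one line, so with four points per
    line the lines are exactly the 4-cliques. Each is listed once, in increasing order. *)
Definition lines_of (T : seq bitseq) : seq (seq nat) :=
  flatten [seq flatten [seq flatten [seq [seq [:: i; j; k; l] |
      l <- iota 0 40 & [&& k < l, tadj T i l, tadj T j l & tadj T k l]]
    | k <- iota 0 40 & [&& j < k, tadj T i k & tadj T j k]]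
    | j <- iota 0 40 & (i < j) && tadj T i j]
    | i <- iota 0 40].

Definition LW := Eval vm_compute in lines_of TW.
Definition LQ := Eval vm_compute in lines_of TQ.

(** * Hyperovals of W(3) and Q_4(3) *)

Definition zero_or_two (n : nat) := match n with 0 | 2 => true | _ => false end.

Definition hyper (L : seq (seq nat)) (s : bitseq) :=
  all (fun l => zero_or_two (count (nth false s) l)) L.

(* The line constraints that can be tested once points 0..i are decided; the
   partial set is stored in reverse, so point x sits at offset i - x. *)
Definition constr (L : seq (seq nat)) : seq (seq (seq nat * bool)) :=
  [seq [seq ([seq i - x | x <- l & x <= i], all (fun x => x <= i) l)
       | l <- L & i \in l] | i <- iota 0 40].

Definition okb (c : seq (seq nat * bool)) (s : bitseq) : bool :=
  lall (fun p => let n := count (nth false s) p.1 in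
                 if p.2 then zero_or_two n else n <= 2) c.

Fixpoint enum_sets (cs : seq (seq (seq nat * bool))) (s : bitseq) : seq bitseq :=
  if cs is c :: cs' then
    (if okb c (false :: s) then enum_sets cs' (false :: s) else [::]) ++
    (if okb c (true :: s) then enum_sets cs' (true :: s) else [::])
  else [:: rev s].

Lemma enum_sets_complete cs s t : size t = size cs ->
  (forall k, k < size cs -> okb (nth [::] cs k) (catrev (take k.+1 t) s)) ->
  rev s ++ t \in enum_sets cs s.
Proof.
elim: cs s t => [|c cs IH] s [|b t] //= => [_ _|[st] h]; first by rewrite cats0 mem_head.
have h0 := h 0 isT; rewrite /= take0 /= in h0.
have -> : rev s ++ b :: t = rev (b :: s) ++ t by rewrite rev_cons cat_rcons.
rewrite mem_cat; apply/orP; case: b h0 h => h0 h; [right|left];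
  by rewrite h0; apply: IH => // k hk; exact: (h k.+1 hk).
Qed.

(** The search never prunes a hyperoval: forgetting the later points can only lower the count on a
    line, so every partial test is passed. *)
Lemma hyper_enum L s : all (all (fun x => x < 40)) L -> size s = 40 -> hyper L s ->
  s \in enum_sets (constr L) [::].
Proof.
move=> /allP hL hs /allP h; rewrite -[s]/(rev [::] ++ s).
apply: enum_sets_complete; first by rewrite hs size_map size_iota.
move=> i; rewrite size_map size_iota => hi.
rewrite (nth_map 0) ?size_iota // nth_iota // add0n /okb lallE.
apply/allP => p /mapP [l]; rewrite mem_filter => /andP [_ hl] -> /=.
have cE : count (nth false (catrev (take i.+1 s) [::])) [seq i - x | x <- l & x <= i]
          = count (predI (nth false s) (fun x => x <= i)) l.
  rewrite count_map count_filter; apply: eq_in_count => x hx /=.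
  case: leqP => hxi; rewrite ?andbF //= !andbT.
  have st : size (take i.+1 s) = i.+1 by rewrite size_takel ?hs.
  rewrite -[catrev _ _]/(rev _) nth_rev st ?ltnS ?leq_subr //.
  by rewrite subSS subKn // nth_take.
rewrite cE; have := h _ hl; case: ifP => [/allP ha|_].
  have -> // : count (predI (nth false s) (fun x => x <= i)) l = count (nth false s) l.
  by apply: eq_in_count => x hx /=; rewrite ha ?andbT.
have le: count (predI (nth false s) (leq^~ i)) l <= count (nth false s) l.
  by apply: sub_count => x /andP [].
by move=> h2; apply: leq_trans le _; case: (count _ l) h2 => [|[|[]]].
Qed.

Definition HW := Eval vm_compute in enum_sets (constr LW) [::].
Definition HQ := Eval vm_compute in enum_sets (constr LQ) [::].
Lemma HWE : enum_sets (constr LW) [::] = HW.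
Proof. by vm_cast_no_check (erefl HW). Qed.
Lemma HQE : enum_sets (constr LQ) [::] = HQ.
Proof. by vm_cast_no_check (erefl HQ). Qed.

(** * Finite checks on the quadrangles and their hyperovals *)

Definition common2 (T : seq bitseq) i j :=
  [seq k <- iota 0 40 | tadj T i k && tadj T j k].

(** Two collinear points determine a line of four points. In the neighbourhood of u this puts every
    triangle through u in exactly one 5-clique. *)
Definition chk_triangle T := all40 (fun i => all40 (fun j =>
  if tadj T i j then if common2 T i j is [:: k; l] then tadj T k l else false
  else true)).

Definition chk_gq T := all40 (fun i => all40 (fun j =>
  if tadj T i j then lall (fun k => lall (fun l =>
    if tadj T k l then all40 (fun y =>
      [|| y == i, y == j, y == k, y == l, tadj T y i, tadj T y j, tadj T y k | tadj T y l])
    else true) (common2 T i j)) (common2 T i j) else true)).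

Definition far T i j := ~~ tadj T i j && (i != j).

(** The roles in Γ(w) are o = u, a = v, a' = v'. If a and a' are collinear, the only common
    neighbour of the three is the point of their line collinear with o; otherwise the count depends
    on the type of the quadrangle. *)
Definition chk_agree T (P : bool -> nat -> bool) := all40 (fun o => all40 (fun a =>
  if far T o a then all40 (fun a' => if far T o a' then if a != a' then
    P (tadj T a a') (cnt3 (nth [::] T o) (nth [::] T a) (nth [::] T a'))
  else true else true) else true)).

Definition okW (n : nat) := match n with 1 | 4 => true | _ => false end.
Definition ok1 (n : nat) := match n with 1 => true | _ => false end.

Definition chk_far T := all40 (fun i => all40 (fun j =>
  lhas (fun k => if far T k i then far T k j else false) (iota 0 40))).

Definition chk_nbr T := all40 (fun i => lhas (tadj T i) (iota 0 40)).

(** Read in Γ(w) with o = u: the path z, w, z' of Γ(u) lies in the hyperoval of the vertex a. *)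
Definition chk_path T := all40 (fun o => all40 (fun z => if tadj T o z then
  all40 (fun z' => if tadj T o z' then if far T z z' then
    lhas (fun a => if far T o a then tadj T z a && tadj T z' a else false) (iota 0 40)
  else true else true) else true)).

(** In Q_4(3) three pairwise noncollinear points with a common neighbour o have exactly one more, a.
    Read in Γ(w) with o = u, every claw of Γ(u) with centre w lies in the hyperoval of the vertex
    a. *)
Definition chk_claw T := all40 (fun o =>
  let zs := [seq z <- iota 0 40 | tadj T o z] in
  lall (fun z => lall (fun z' => if far T z z' then
    let cs := [seq a <- common2 T z z' | far T o a] in
    lall (fun z'' => if far T z z'' then if far T z' z'' then
      lhas (fun a => tadj T z'' a) cs else true else true) zs
  else true) zs) zs).

Lemma triangleW : chk_triangle TW. Proof. by vm_cast_no_check isT. Qed.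
Lemma triangleQ : chk_triangle TQ. Proof. by vm_cast_no_check isT. Qed.
Lemma gqW : chk_gq TW. Proof. by vm_cast_no_check isT. Qed.
Lemma gqQ : chk_gq TQ. Proof. by vm_cast_no_check isT. Qed.
Lemma agreeW : chk_agree TW (fun=> okW). Proof. by vm_cast_no_check isT. Qed.
Lemma agreeQ : chk_agree TQ (fun b => if b then ok1 else zero_or_two).
Proof. by vm_cast_no_check isT. Qed.
Lemma farW : chk_far TW. Proof. by vm_cast_no_check isT. Qed.
Lemma farQ : chk_far TQ. Proof. by vm_cast_no_check isT. Qed.
Lemma nbrW : chk_nbr TW. Proof. by vm_cast_no_check isT. Qed.
Lemma nbrQ : chk_nbr TQ. Proof. by vm_cast_no_check isT. Qed.
Lemma pathW : chk_path TW. Proof. by vm_cast_no_check isT. Qed.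
Lemma clawQ : chk_claw TQ. Proof. by vm_cast_no_check isT. Qed.

Definition card_of (m : bitseq) := count id m.

(* Together with the size of m, this graph invariant tells the hyperovals of W(3)
   from those of Q_4(3). *)
Definition c2 T (m : bitseq) (i : nat) :=
  count (fun j => if nth false m j then if far T i j then
    cnt3 m (nth [::] T i) (nth [::] T j) == 2 else false else false) (iota 0 40).

Definition four_dvd n := n %% 4 == 0.

(** One point is tested here but all points in [chk_typeQ], because an isomorphism may send the
    chosen point anywhere. *)
Definition chk_typeW := lall (fun m => if four_dvd (card_of m) then
  let i := find id m in let n := c2 TW m i in (n == 0) || (n == 3) else false) HW.
Definition chk_typeQ := lall (fun m => if four_dvd (card_of m) then
  all40 (fun i => if nth false m i then
    let n := c2 TQ m i in ~~ ((n == 0) || (n == 3)) else true)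
  else true) HQ.
Lemma typeW : chk_typeW. Proof. by vm_cast_no_check isT. Qed.
Lemma typeQ : chk_typeQ. Proof. by vm_cast_no_check isT. Qed.

Fixpoint compat_rec (ok : nat -> bool) (M M' a b : bitseq) (T : seq bitseq) : bool :=
  match a, b, T with
  | x :: a', y :: b', r :: T' =>
      if x then if y then
        if ok (cnt3 M M' r) then compat_rec ok M M' a' b' T' else false
      else compat_rec ok M M' a' b' T' else compat_rec ok M M' a' b' T'
  | _, _, _ => true
  end.
Definition compat ok T M M' := compat_rec ok M M' M M' T.

Definition contains (q : seq nat) (m : bitseq) := lall (nth false m) q.

Inductive rtree := Ask of nat & nat & nat & nat & seq rtree.

(** Supplies the induction hypothesis for each subtree in the list of children, as [refute_far]
    requires. *)
Lemma rtree_nested_ind (P : rtree -> Prop) :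
  (forall w x y z ts, (forall t, List.In t ts -> P t) -> P (Ask w x y z ts)) ->
  forall t, P t.
Proof.
move=> H; fix IH 1 => -[w x y z ts]; apply: H.
elim: ts => [|t ts IHts] t' /=; first by case.
by case=> [<-|h]; [exact: (IH t)|exact: (IHts _ h)].
Qed.

(** Whether v and v' are adjacent does not depend on the common point w, so one of the two rules
    must hold at all common points simultaneously. *)
Definition compatQ M M' := if compat ok1 TQ M M' then true else compat zero_or_two TQ M M'.

(* A node queries a claw; its children refute the hyperovals through the claw
   that are compatible with all those chosen so far, in the order of HQ. *)
Fixpoint refute (t : rtree) (chosen : seq bitseq) : bool :=
  let: Ask w x y z ts := t in let q := [:: w; x; y; z] in
  [&& [&& w < 40, x < 40, y < 40 & z < 40],
      [&& tadj TQ w x, tadj TQ w y, tadj TQ w z, far TQ x y, far TQ x z & far TQ y z],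
      ~~ has (contains q) chosen &
      (fix go (ts : seq rtree) (ms : seq bitseq) {struct ts} :=
         match ts, ms with
         | t' :: ts', m :: ms' => refute t' (m :: chosen) && go ts' ms'
         | [::], [::] => true
         | _, _ => false
         end) ts [seq m <- HQ | if contains q m then lall (compatQ m) chosen else false]].

Definition refute_all (chosen : seq bitseq) :=
  fix go (ts : seq rtree) (ms : seq bitseq) {struct ts} : bool :=
  match ts, ms with
  | t' :: ts', m :: ms' => refute t' (m :: chosen) && go ts' ms'
  | [::], [::] => true
  | _, _ => false
  end.

Lemma refuteE w x y z ts chosen : refute (Ask w x y z ts) chosen =
  [&& [&& w < 40, x < 40, y < 40 & z < 40],
      [&& tadj TQ w x, tadj TQ w y, tadj TQ w z, far TQ x y, far TQ x z & far TQ y z],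
      ~~ has (contains [:: w; x; y; z]) chosen &
      refute_all chosen ts
        [seq m <- HQ | if contains [:: w; x; y; z] m then lall (compatQ m) chosen else false]].
Proof. by []. Qed.

(** A certificate for [refute]. A node without children is a claw through which no hyperoval
    compatible with the chosen ones is left. *)
Definition the_tree : rtree :=
  Ask 0 1 7 19 [:: Ask 5 2 8 18 [:: Ask 0 2 7 23 [::]; Ask 0 1 8 19 [::]; Ask 5 4 10 18
  [::]]; Ask 7 0 12 35 [::]; Ask 0 1 8 31 [:: Ask 0 1 7 28 [::]]; Ask 5 2 10 18 [:: Ask
  0 1 9 30 [::]; Ask 5 6 10 29 [::]; Ask 0 1 7 30 [::]]; Ask 1 0 11 18 [::]; Ask 0 1 7
  23 [:: Ask 0 1 7 28 [::]; Ask 0 1 7 28 [::]; Ask 2 0 6 25 [::]; Ask 0 1 8 27 [::]];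
  Ask 0 1 9 28 [::]; Ask 1 0 11 34 [::]; Ask 0 1 8 31 [::]; Ask 0 1 7 23 [:: Ask 3 0 14
  29 [::]; Ask 0 1 7 27 [::]; Ask 0 1 7 27 [::]; Ask 0 1 8 23 [::]]; Ask 0 1 9 28 [::];
  Ask 0 1 7 23 [:: Ask 0 1 8 28 [::]; Ask 0 1 7 28 [:: Ask 0 1 8 23 [:: Ask 0 1 8 28
  [::]]]; Ask 0 1 8 27 [::]]; Ask 1 0 12 35 [::]; Ask 15 3 9 33 [:: Ask 0 2 9 19 [::];
  Ask 0 1 9 23 [::]; Ask 12 1 14 30 [::]]; Ask 0 1 9 28 [:: Ask 0 1 7 28 [::]]; Ask 0 1
  7 23 [::]; Ask 0 1 9 28 [:: Ask 0 1 7 28 [::]]; Ask 0 1 7 23 [::]; Ask 0 1 9 19 [::];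
  Ask 1 0 11 18 [::]; Ask 7 0 12 22 [::]; Ask 0 1 8 27 [::]; Ask 1 0 12 22 [::]; Ask 0
  1 8 27 [::]; Ask 0 1 7 23 [::]; Ask 1 0 12 38 [::]; Ask 0 1 8 27 [:: Ask 0 1 7 27
  [::]]; Ask 0 1 9 30 [::]; Ask 0 1 7 23 [::]; Ask 0 1 9 30 [:: Ask 0 1 7 27 [::]]; Ask
  0 1 7 23 [:: Ask 0 1 8 19 [::]; Ask 0 1 9 28 [::]; Ask 0 1 7 27 [:: Ask 0 1 8 19 [::
  Ask 0 1 8 27 [::]]]]; Ask 0 1 8 27 [:: Ask 0 1 7 27 [::]]; Ask 0 1 8 19 [::]].

Lemma the_tree_refutes : refute the_tree [::]. Proof. by vm_cast_no_check isT. Qed.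

(* Each hyperoval of W(3) with more than 8 points is incompatible with every
   hyperoval through one of these paths; the list is a greedy cover. *)
Definition queries : seq (nat * nat * nat) :=
  [:: (0, 1, 7); (0, 16, 32); (1, 0, 10); (2, 11, 20); (4, 3, 32); (5, 4, 14); (10, 1,
  13); (12, 6, 31); (14, 2, 8); (25, 7, 37); (31, 22, 30); (8, 5, 21); (9, 0, 27); (17,
  3, 8); (37, 1, 6); (6, 21, 37); (19, 24, 32); (39, 35, 37); (11, 10, 24); (20, 18,
  32); (27, 20, 23); (3, 6, 29); (29, 14, 34); (26, 27, 29); (36, 8, 19); (34, 1, 4);
  (7, 12, 29); (16, 5, 23); (21, 6, 35); (35, 33, 36); (30, 0, 15); (32, 14, 36); (15,
  28, 34); (12, 11, 32); (22, 0, 29); (29, 17, 26); (33, 5, 25); (23, 14, 16); (24, 25,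
  39); (13, 6, 38); (18, 9, 16); (31, 22, 25); (3, 5, 24); (6, 22, 37); (16, 12, 26);
  (4, 20, 31); (27, 28, 33); (28, 13, 27); (11, 12, 36); (26, 6, 30); (38, 10, 36);
  (39, 3, 32); (2, 1, 25); (18, 2, 39); (22, 0, 18); (24, 15, 27); (1, 0, 19); (7, 8,
  24); (30, 21, 31); (33, 25, 35); (31, 4, 12); (32, 12, 28); (5, 15, 16); (15, 8, 11);
  (4, 9, 20); (8, 5, 17); (11, 4, 35); (17, 16, 37); (21, 22, 30); (25, 7, 33); (13, 7,
  15); (23, 21, 38); (37, 15, 33); (3, 1, 4); (7, 13, 19); (34, 23, 29); (38, 13, 16);
  (0, 3, 8); (8, 0, 14); (10, 1, 38); (14, 23, 26); (18, 5, 31); (19, 7, 32); (27, 26,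
  35); (1, 10, 37); (11, 10, 16); (21, 8, 30); (26, 10, 24); (35, 5, 21); (37, 15, 17);
  (39, 9, 38); (5, 3, 8); (6, 7, 23); (13, 10, 28); (36, 2, 6); (2, 1, 13); (8, 7, 14);
  (10, 4, 19); (12, 1, 7); (23, 16, 25); (35, 11, 33); (0, 1, 8); (3, 0, 5); (25, 4,
  14)].

Definition query_opts :=
  [seq (q, [seq m <- HW | contains [:: q.1.1; q.1.2; q.2] m]) | q <- queries].

(* A heuristic filter that skips queries which would not refute m. *)
Definition typical (m : bitseq) (w : nat) :=
  cnt3 m m (nth [::] TW w) ==
  match card_of m with 12 => 6 | 16 => 4 | _ => 8 end.

(** The centre w must lie outside m: then a hyperoval through the path belongs to a vertex other
    than that of m, and the two have to be compatible. *)
Definition kills (m : bitseq) (qo : (nat * nat * nat) * seq bitseq) :=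
  let: ((w, z, z'), ms) := qo in
  if nth false m w then false else if typical m w then
    lall (fun m' => if compat okW TW m m' then false else true) ms
  else false.

Definition chk_queries := lall (fun q : nat * nat * nat =>
  [&& q.1.1 < 40, q.1.2 < 40, q.2 < 40, tadj TW q.1.1 q.1.2, tadj TW q.1.1 q.2
    & far TW q.1.2 q.2]) queries.
Lemma queriesP : chk_queries. Proof. by vm_cast_no_check isT. Qed.

Definition small m := card_of m <= 8.

Definition chk_kill := let qo := query_opts in
  lall (fun m => if small m then true else lhas (kills m) qo) HW.
Lemma killP : chk_kill. Proof. by vm_cast_no_check isT. Qed.

(** A hyperoval contains no triangle, since a line meets it in at most two points. With this
    condition an edge therefore forces it to be complete bipartite. *)
Definition chk_K44 := lall (fun m => if small m then
   all40 (fun p => if nth false m p then all40 (fun q => if nth false m q then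
     if tadj TW p q then all40 (fun x => if nth false m x then tadj TW x p || tadj TW x q else true)
     else true else true) else true) else true) HW.
Lemma K44P : chk_K44. Proof. by vm_cast_no_check isT. Qed.

(** Positions in [ptsW] of a hyperbolic line of W(3); [PB] is its perp, and together they form a
    K_{4,4}. *)
Definition PA := [:: 32; 35; 37; 38].
Definition PB := [:: 33; 34; 36; 39].
Definition chk_PAB := [&& all (fun p => p < 40) (PA ++ PB),
  all (fun p => all (tadj TW p) PB) PA,
  all (fun i => all (fun j => (i == j) || far TW (nth 0 PA i) (nth 0 PA j)) (iota 0 4)) (iota 0 4) &
  all (fun i => all (fun j => (i == j) || far TW (nth 0 PB i) (nth 0 PB j)) (iota 0 4)) (iota 0 4)].
Lemma PABP : chk_PAB. Proof. by vm_cast_no_check isT. Qed.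
(** A path with centre in [PA] and both ends in [PB] already determines the small hyperoval. *)
Definition chk_frame := lall (fun m => if small m then
   if contains [:: 32; 33; 34] m then contains (PA ++ PB) m else true else true) HW.
Lemma frameP : chk_frame. Proof. by vm_cast_no_check isT. Qed.

Definition chk_perp T := all40 (fun i => all40 (fun j => if far T i j then
  if common2 T i j is [:: a; b; c; d] then
   [&& far T a b, far T a c, far T a d, far T b c, far T b d & far T c d] else false else true)).
Lemma perpP : chk_perp TW. Proof. by vm_cast_no_check isT. Qed.

(** Take b, b' and l, l' as the hyperbolic pairs of a basis. The coordinates β, β', λ, λ' of c are
    then nonzero. Solving for the points that c sees on the four sides gives, up to sign, ββ' + λλ'
    as the product of x and x', and ββ' - λλ' as that of y and y'. Since ββ' and λλ' are 1 or -1 in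
    F_3, exactly one of the two vanishes. *)
Definition chk_parity T := all40 (fun b => all40 (fun b' => if far T b b' then if b < b' then
  let cs := common2 T b b' in
  lall (fun l => lall (fun l' => if l < l' then
   let xs := common2 T b l in let xs' := common2 T b' l' in
   let ys := common2 T b l' in let ys' := common2 T b' l in
   all40 (fun c => if tadj T c b then true else if tadj T c b' then true else
     if tadj T c l then true else if tadj T c l' then true else
     let r := nth [::] T c in
     lall (fun x => if nth false r x then lall (fun x' => if nth false r x' then
       lall (fun y => if nth false r y then lall (fun y' => if nth false r y' then
         tadj T x x' (+) tadj T y y' else true) ys' else true) ys
       else true) xs' else true) xs) else true) cs) cs
  else true else true)).
Lemma parityP : chk_parity TW. Proof. by vm_cast_no_check isT. Qed.

Definition wf_table (T : seq bitseq) := (size T == 40) && all (fun r : bitseq => size r == 40) T.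

Definition wf_lines (T : seq bitseq) (L : seq (seq nat)) := all (fun l =>
  if l is [:: i; j; k; h] then
    [&& [&& i < 40, j < 40, k < 40 & h < 40],
        [&& tadj T i j, tadj T i k & tadj T i h],
        [&& tadj T j k, tadj T j h & tadj T k h] & [&& i < j, j < k & k < h]]
  else false) L.

Lemma wfW : wf_table TW && wf_lines TW LW. Proof. by vm_cast_no_check isT. Qed.
Lemma wfQ : wf_table TQ && wf_lines TQ LQ. Proof. by vm_cast_no_check isT. Qed.

Lemma wf_size T i : wf_table T -> i < 40 -> size (nth [::] T i) = 40.
Proof.
case/andP => /eqP sT /allP h hi; apply/eqP/h/mem_nth; by rewrite sT.
Qed.

Lemma chk_farP T i j : chk_far T -> i < 40 -> j < 40 ->
  exists2 k, k < 40 & far T k i && far T k j.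
Proof.
move=> /all40P h hi hj; have /all40P /(_ _ hj) := h _ hi.
rewrite lhasE => /hasP [k]; rewrite mem_iota /= => hk hf; exists k => //;
  by move: hf; case: (far T k i).
Qed.

Lemma mem_common2 T i j k :
  (k \in common2 T i j) = [&& k < 40, tadj T i k & tadj T j k].
Proof. by rewrite mem_filter mem_iota andbC. Qed.

Lemma chk_clawP T o i j k : chk_claw T -> o < 40 -> i < 40 -> j < 40 -> k < 40 ->
  [&& tadj T o i, tadj T o j & tadj T o k] -> [&& far T i j, far T i k & far T j k] ->
  exists2 a, a < 40 & [&& far T o a, tadj T i a, tadj T j a & tadj T k a].
Proof.
rewrite /chk_claw => /all40P h ho hi hj hk /and3P [oi oj ok] /and3P [ij ik jk].
have := h _ ho; cbv zeta; set zs := filter _ _.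
have zsP l : l < 40 -> tadj T o l -> l \in zs by rewrite mem_filter mem_iota40 => -> ->.
rewrite lallE => /allP /(_ i (zsP _ hi oi)); rewrite lallE => /allP /(_ j (zsP _ hj oj)).
rewrite ij lallE => /allP /(_ k (zsP _ hk ok)); rewrite ik jk lhasE => /hasP [a].
rewrite mem_filter mem_common2 => /andP [foa /and3P [ha ia ja]] ka.
by exists a; rewrite // foa ia ja ka.
Qed.

Lemma chk_pathP T o i j : chk_path T -> o < 40 -> i < 40 -> j < 40 ->
  [&& tadj T o i, tadj T o j & far T i j] ->
  exists2 a, a < 40 & [&& far T o a, tadj T i a & tadj T j a].
Proof.
rewrite /chk_path => /all40P h ho hi hj /and3P [oi oj ij].
have /all40P /(_ _ hi) := h _ ho; rewrite oi => /all40P /(_ _ hj); rewrite oj ij.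
rewrite lhasE => /hasP [a]; rewrite mem_iota40 => ha; case: ifP => // foa iaj.
by exists a; rewrite // foa.
Qed.

Lemma killsP m w x y ms : kills m ((w, x, y), ms) ->
  ~~ nth false m w /\ forall m', m' \in ms -> ~~ compat okW TW m m'.
Proof.
rewrite /kills; case: (nth false m w) => //; case: (typical m w) => //.
by rewrite lallE => /allP h; split=> // m' /h; case: (compat okW TW m m').
Qed.

(** * Local structure *)

Section Graph.
Variables (V : eqType) (adj : rel V).
Hypothesis adjC : symmetric adj.
Hypothesis adjxx : irreflexive adj.

Definition chart T (u : V) (e : nat -> V) : Prop :=
  [/\ forall i, i < 40 -> adj u (e i),
      forall i j, i < 40 -> j < 40 -> e i = e j -> i = j,
      forall v, adj u v -> exists2 i, i < 40 & v = e i
    & forall i j, i < 40 -> j < 40 -> adj (e i) (e j) = tadj T i j].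

Definition isW u := exists e, chart TW u e.
Definition isQ u := exists e, chart TQ u e.

(** For v at distance two from the centre of the chart this is the hyperoval of v as a bit row, in
    the format of [HW] and [HQ]. *)
Definition prof (e : nat -> V) (v : V) : bitseq := [seq adj v (e i) | i <- iota 0 40].

Lemma size_prof e v : size (prof e v) = 40.
Proof. by rewrite size_map size_iota. Qed.

Lemma nth_prof e v i : i < 40 -> nth false (prof e v) i = adj v (e i).
Proof. by move=> hi; rewrite (nth_map 0) ?size_iota // nth_iota. Qed.

Lemma chart_far T u e i j : chart T u e -> i < 40 -> j < 40 ->
  far T i j = ~~ adj (e i) (e j) && (e i != e j).
Proof.
case=> _ inj _ ad hi hj; rewrite /far ad //; congr (_ && ~~ _).
by apply/eqP/eqP => [->//|]; apply: inj.
Qed.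

Definition triangle_axiom := forall u p q, adj u p -> adj u q -> adj p q ->
  exists s t, [/\ adj s t, [/\ adj u s, adj p s & adj q s],
    [/\ adj u t, adj p t & adj q t] &
    forall y, adj u y -> adj p y -> adj q y -> y = s \/ y = t].

Definition clique5 u p q r s := [&& [&& adj u p, adj u q, adj u r & adj u s],
  [&& adj p q, adj p r & adj p s], adj q r, adj q s & adj r s].

(** No outside vertex sees exactly one vertex of a 5-clique. By [clique5_max] none sees three, which
    leaves 0 or 2. *)
Definition gq_axiom := forall u p q r s y, clique5 u p q r s -> adj u y ->
  [|| y == p, y == q, y == r, y == s, adj y p, adj y q, adj y r | adj y s].

Lemma clique5_max u p q r s y : triangle_axiom -> clique5 u p q r s ->
  adj u y -> adj p y -> adj q y -> y = r \/ y = s.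
Proof.
move=> tri /and5P [/and4P [up uq ur us] /and3P [pq pr ps] qr qs rs] uy py qy.
have [a [b [ab _ _ h]]] := tri _ _ _ up uq pq.
case: (h _ ur pr qr) (h _ us ps qs) (h _ uy py qy) rs => -> [] -> [] ->;
  rewrite ?adjxx //; auto.
Qed.

Section Chart.
Variables (T : seq bitseq) (L : seq (seq nat)) (u : V) (e : nat -> V).
Hypotheses (wfT : wf_table T) (wfL : wf_lines T L).
Hypothesis ch : chart T u e.

Lemma chart_triangle p q : chk_triangle T -> adj u p -> adj u q -> adj p q ->
  exists s t, [/\ adj s t, [/\ adj u s, adj p s & adj q s],
    [/\ adj u t, adj p t & adj q t] &
    forall y, adj u y -> adj p y -> adj q y -> y = s \/ y = t].
Proof.
case: ch => eu inj surj ad /all40P chk up uq pq.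
have [i hi pE] := surj _ up; have [j hj qE] := surj _ uq; subst p q.
have /all40P /(_ _ hj) := chk _ hi; rewrite -ad // pq.
case cE: (common2 T i j) => [|k [|l []]] // kl.
have mem m : m \in [:: k; l] = [&& m < 40, tadj T i m & tadj T j m].
  by rewrite -cE mem_common2.
have /and3P [hk ik jk] : [&& k < 40, tadj T i k & tadj T j k] by rewrite -mem mem_head.
have /and3P [hl il jl] : [&& l < 40, tadj T i l & tadj T j l] by rewrite -mem !inE eqxx orbT.
exists (e k), (e l); rewrite !ad // !eu //; split=> // y uy iy jy.
have [m hm yE] := surj _ uy; subst y.
have : m \in [:: k; l] by rewrite mem hm -!ad // iy jy.
by rewrite !inE => /orP [] /eqP ->; [left|right].
Qed.

Lemma chart_gq p q r s y : chk_gq T -> clique5 u p q r s -> adj u y ->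
  [|| y == p, y == q, y == r, y == s, adj y p, adj y q, adj y r | adj y s].
Proof.
case: ch => eu inj surj ad /all40P chk /and5P [/and4P [up uq ur us] /and3P [pq pr ps] qr qs rs] uy.
have [i hi pE] := surj _ up; have [j hj qE] := surj _ uq; have [k hk rE] := surj _ ur.
have [l hl sE] := surj _ us; have [m hm yE] := surj _ uy; subst p q r s y.
have /all40P /(_ _ hj) := chk _ hi; rewrite -ad // pq lallE => /allP /(_ k).
have ck : k \in common2 T i j by rewrite mem_common2 hk -!ad // pr qr.
have cl : l \in common2 T i j by rewrite mem_common2 hl -!ad // ps qs.
move=> /(_ ck); rewrite lallE => /allP /(_ _ cl); rewrite -ad // rs => /all40P /(_ _ hm).
rewrite -!ad //; do 4 (case: eqP => [->|_]; first by rewrite eqxx ?orbT).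
by move=> /= ->; rewrite !orbT.
Qed.

(** A line of Γ(u) together with u is a 5-clique. The vertex v misses u, so it sees no point of the
    line or exactly two: [one] excludes a single point and [three] excludes more than two. *)
Lemma chart_hyper v : triangle_axiom -> gq_axiom -> v != u -> ~~ adj u v ->
  hyper L (prof e v).
Proof.
case: ch => eu inj surj ad tri gq vu nuv; apply/allP => l /(allP wfL).
case: l => [|i [|j [|k [|h []]]]] //.
case/and4P => /and4P [hi hj hk hh] /and3P [ij ik ih] /and3P [jk jh kh] _.
have nvu : ~~ adj v u by rewrite adjC.
have vn x : adj u x -> v != x by move=> ux; apply: contraNneq nuv => ->.
have [[[ui uj] uk] uh] := (eu _ hi, eu _ hj, eu _ hk, eu _ hh).
rewrite -!ad // in ij ik ih jk jh kh.
have one a b c d : adj u a -> adj u b -> adj u c -> adj u d ->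
    adj a b -> adj a c -> adj a d -> adj b c -> adj b d -> adj c d ->
    adj v a ==> [|| adj v b, adj v c | adj v d].
  move=> ua ub uc ud ab ac ad' bc bd cd; apply/implyP => va.
  have := gq a u b c d v; rewrite /clique5 !ub !uc !ud !ab !ac !ad' !bc !bd !cd.
  rewrite adjC ua adjC va => /(_ isT isT).
  by rewrite (negPf vu) !(negPf (vn _ _)) // (negPf nvu).
have three a b c d : adj u a -> adj u b -> adj u c -> adj u d ->
    adj a b -> adj a c -> adj a d -> adj b c -> adj b d -> adj c d ->
    ~~ [&& adj v a, adj v b & adj v c].
  move=> ua ub uc ud ab ac ad' bc bd cd; apply/negP => /and3P [va vb vc].
  have cl : clique5 a b c u d.
    by rewrite /clique5 ab ac ad' bc bd cd ud ![adj _ u]adjC ua ub uc.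
  have [] : v = u \/ v = d by apply: (clique5_max tri cl); rewrite adjC.
    by move=> vE; rewrite vE eqxx in vu.
  by move=> vE; have := vn d ud; rewrite vE eqxx.
have [ji ki hi'] : [/\ adj (e j) (e i), adj (e k) (e i) & adj (e h) (e i)].
  by rewrite ![adj _ (e i)]adjC.
have [kj hj' hk'] : [/\ adj (e k) (e j), adj (e h) (e j) & adj (e h) (e k)].
  by rewrite ![adj _ (e j)]adjC [adj (e h) _]adjC.
have := one _ _ _ _ ui uj uk uh ij ik ih jk jh kh.
have := one _ _ _ _ uj ui uk uh ji jk jh ik ih kh.
have := one _ _ _ _ uk ui uj uh ki kj kh ij ih jh.
have := one _ _ _ _ uh ui uj uk hi' hj' hk' ij ik jk.
have := three _ _ _ _ ui uj uk uh ij ik ih jk jh kh.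
have := three _ _ _ _ ui uj uh uk ij ih ik jh jk hk'.
have := three _ _ _ _ ui uk uh uj ik ih ij kh kj hj'.
have := three _ _ _ _ uj uk uh ui jk jh ji kh ki hi'.
rewrite /= !nth_prof //.
by case: (adj v (e i)); case: (adj v (e j)); case: (adj v (e k)); case: (adj v (e h)).
Qed.

End Chart.

(** Vertices adjacent to both centres are enumerated by both charts, so a count over them may be
    moved from one chart to the other. *)
Lemma count_charts T T' u u' e e' (P : pred V) : chart T u e -> chart T' u' e' ->
  (forall x, P x -> adj u x && adj u' x) ->
  count (fun i => P (e i)) (iota 0 40) = count (fun i => P (e' i)) (iota 0 40).
Proof.
move=> [eu inj surj _] [eu' inj' surj' _] PP.
have sub f : count (fun i => P (f i)) (iota 0 40) = size [seq x <- map f (iota 0 40) | P x].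
  by rewrite size_filter count_map.
rewrite !sub; apply/perm_size/uniq_perm.
- rewrite filter_uniq // map_inj_in_uniq ?iota_uniq // => i j.
  by rewrite !mem_iota; apply: inj.
- rewrite filter_uniq // map_inj_in_uniq ?iota_uniq // => i j.
  by rewrite !mem_iota; apply: inj'.
move=> x; rewrite !mem_filter; case Px: (P x) => //=.
have /andP [ux ux'] := PP _ Px.
have [i hi xi] := surj _ ux; have [j hj xj] := surj' _ ux'.
have -> : x \in map e (iota 0 40) by apply/mapP; exists i; rewrite ?mem_iota.
have -> // : x \in map e' (iota 0 40) by apply/mapP; exists j; rewrite ?mem_iota.
Qed.

Lemma cnt3_prof T u e v v' i : wf_table T -> chart T u e -> i < 40 ->
  cnt3 (prof e v) (prof e v') (nth [::] T i) =
  count (fun k => [&& adj u (e k), adj (e i) (e k), adj v (e k) & adj v' (e k)]) (iota 0 40).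
Proof.
move=> wfT [eu _ _ ad] hi; rewrite (cnt3E (n := 40)) ?size_prof ?wf_size //.
apply: eq_in_count => k; rewrite mem_iota /= => hk.
by rewrite !nth_prof // -/(tadj T i k) -ad // eu //= [RHS]andbC andbA.
Qed.

(** The change of centre from u to w = [e i]: shared points of two hyperovals around w become common
    neighbours of three points of Γ(w). *)
Lemma cnt3_trace T T' u e i e' v v' :
  wf_table T -> wf_table T' -> chart T u e -> i < 40 -> chart T' (e i) e' ->
  adj (e i) v -> adj (e i) v' ->
  exists o a a', [/\ [/\ o < 40, a < 40 & a' < 40], [/\ u = e' o, v = e' a & v' = e' a'] &
  cnt3 (prof e v) (prof e v') (nth [::] T i) =
  cnt3 (nth [::] T' o) (nth [::] T' a) (nth [::] T' a')].
Proof.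
move=> wfT wfT' ch hi ch' iv iv'; case: (ch) => eu _ _ ad; case: (ch') => eu' _ surj' ad'.
have iu : adj (e i) u by rewrite adjC eu.
have [o ho uE] := surj' _ iu; have [a ha vE] := surj' _ iv; have [a' ha' vE'] := surj' _ iv'.
exists o, a, a'; split => //; rewrite (cnt3_prof _ _ wfT ch hi).
rewrite (count_charts (P := fun x => [&& adj u x, adj (e i) x, adj v x & adj v' x]) ch ch').
  rewrite (cnt3E (n := 40)) ?wf_size //; apply: eq_in_count => k; rewrite mem_iota /= => hk.
  by rewrite -!/(tadj T' _ _) -!ad' // -uE -vE -vE' eu'.
by move=> x /and4P [-> ->].
Qed.

Lemma compat_recP (ok : nat -> bool) M M' T : forall n a b, size a = n -> size b = n -> size T = n ->
  (forall i, i < n -> nth false a i -> nth false b i -> ok (cnt3 M M' (nth [::] T i))) ->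
  compat_rec ok M M' a b T.
Proof.
elim: T => [|r T IH] [|n] [|x a] [|y b] //= [sa] [sb] [sT] h.
have rec : compat_rec ok M M' a b T by apply: (IH n) => // i hi; apply: (h i.+1).
by case: x y h => [] [] h //; rewrite (h 0).
Qed.

Lemma compatP (ok : nat -> bool) T e v v' : wf_table T ->
  (forall i, i < 40 -> adj v (e i) -> adj v' (e i) ->
     ok (cnt3 (prof e v) (prof e v') (nth [::] T i))) ->
  compat ok T (prof e v) (prof e v').
Proof.
move=> /andP [/eqP sT _] h; apply: (compat_recP (n := 40)); rewrite ?size_prof //.
by move=> i hi; rewrite !nth_prof //; apply: h.
Qed.

Section Local.
Hypothesis types : forall u, isW u \/ isQ u.

Lemma triangleP : triangle_axiom.
Proof.
move=> u p q; case: (types u) => [] [e ch].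
  exact: (chart_triangle ch triangleW).
exact: (chart_triangle ch triangleQ).
Qed.

Lemma gqP : gq_axiom.
Proof.
move=> u p q r s y; case: (types u) => [] [e ch].
  exact: (chart_gq ch gqW).
exact: (chart_gq ch gqQ).
Qed.

Lemma linesLt T L : wf_lines T L -> all (all (fun x => x < 40)) L.
Proof.
move=> /allP h; apply/allP => l /h; case: l => [|i [|j [|k [|m []]]]] //=.
by case/and4P => /and4P [-> -> -> ->].
Qed.

Lemma hyperW u e v : chart TW u e -> v != u -> ~~ adj u v -> prof e v \in HW.
Proof.
move=> ch vu nuv; case/andP: wfW => wT wL.
have := hyper_enum (linesLt wL) (size_prof e v) (chart_hyper wL ch triangleP gqP vu nuv).
by rewrite HWE.
Qed.

Lemma hyperQ u e v : chart TQ u e -> v != u -> ~~ adj u v -> prof e v \in HQ.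
Proof.
move=> ch vu nuv; case/andP: wfQ => wT wL.
have := hyper_enum (linesLt wL) (size_prof e v) (chart_hyper wL ch triangleP gqP vu nuv).
by rewrite HQE.
Qed.

Definition is_far u v := (v != u) && ~~ adj u v.

Lemma c2_prof T u e v i : wf_table T -> chart T u e -> i < 40 ->
  c2 T (prof e v) i = count (fun j => [&& adj u (e j), adj v (e j), ~~ adj (e i) (e j),
    e i != e j & count (fun k => [&& adj u (e k), adj v (e k), adj (e i) (e k)
      & adj (e j) (e k)]) (iota 0 40) == 2]) (iota 0 40).
Proof.
move=> wfT ch hi; case: (ch) => eu _ _ ad.
rewrite /c2; apply: eq_in_count => j; rewrite mem_iota40 => hj; cbv beta.
rewrite nth_prof // (chart_far ch hi hj) eu // andTb.
rewrite (cnt3E (n := 40)) ?size_prof ?wf_size //.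
have -> : count (fun k => [&& nth false (prof e v) k, nth false (nth [::] T i) k
                & nth false (nth [::] T j) k]) (iota 0 40)
    = count (fun k => [&& adj u (e k), adj v (e k), adj (e i) (e k)
      & adj (e j) (e k)]) (iota 0 40).
  apply: eq_in_count => k; rewrite mem_iota40 => hk; cbv beta.
  by rewrite nth_prof // -!/(tadj T _ _) -!ad // eu.
set n := count _ _.
by case: (adj v (e j)); case: (adj (e i) (e j)); case: (e i == e j).
Qed.

Lemma card_prof T u e v : chart T u e ->
  card_of (prof e v) = count (fun j => adj u (e j) && adj v (e j)) (iota 0 40).
Proof.
case=> eu _ _ _; rewrite /card_of count_map; apply: eq_in_count => j.
by rewrite mem_iota40 => hj; cbv beta; rewrite eu.
Qed.

(** The common neighbours of u and v induce one graph, which appears as a nonempty hyperoval in both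
    charts. The size and the numbers [c2] depend on this graph alone, and the two lists disagree on
    them. *)
Lemma far_types u v w : isW u -> isQ v -> is_far u v -> adj u w -> adj v w -> False.
Proof.
move=> [e ch] [e' ch'] /andP [vu nuv] uw vw.
case: (ch) (ch') => eu inj surj ad [eu' inj' surj' ad'].
have nvu : ~~ adj v u by rewrite adjC.
have uv : u != v by rewrite eq_sym.
have mH := hyperW ch vu nuv; have mH' := hyperQ ch' uv nvu.
have [wfT _] := andP wfW; have [wfT' _] := andP wfQ.
have cardE : card_of (prof e v) = card_of (prof e' u).
  rewrite (card_prof _ ch) (card_prof _ ch').
  rewrite (count_charts (P := fun x => adj u x && adj v x) ch ch') //.
  by apply: eq_count => j; rewrite andbC.
have hm : has id (prof e v).
  have [i hi wE] := surj _ uw; apply/hasP; exists true => //.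
  by apply/(nthP false); exists i; rewrite ?size_prof // nth_prof // -wE vw.
have := typeW; rewrite /chk_typeW lallE => /allP /(_ _ mH).
case: ifP => // dvd; set i := find id _ => hc.
have hi : i < 40 by rewrite -(size_prof e v) -has_find.
have vi : adj v (e i) by have := nth_find false hm; rewrite nth_prof.
have [i' hi' iE] := surj' _ vi.
have := typeQ; rewrite /chk_typeQ lallE => /allP /(_ _ mH'); rewrite -cardE dvd.
move=> /all40P /(_ _ hi'); rewrite nth_prof // -iE eu // => /negP; apply.
suff <- : c2 TW (prof e v) i = c2 TQ (prof e' u) i' by [].
rewrite (c2_prof _ wfT ch hi) (c2_prof _ wfT' ch' hi') -iE.
rewrite (count_charts (P := fun y => [&& adj u y, adj v y, ~~ adj (e i) y,
    e i != y & count (fun k => [&& adj u (e k), adj v (e k), adj (e i) (e k)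
      & adj y (e k)]) (iota 0 40) == 2]) ch ch') => [|x /and3P [-> ->] //].
apply: eq_count => j; rewrite !andbA; congr (_ && _ && _ && _); first by rewrite andbC.
congr (_ == 2).
rewrite (count_charts (P := fun z => [&& adj u z, adj v z, adj (e i) z
      & adj (e' j) z]) ch ch') => [|x /and3P [-> ->] //].
by apply: eq_count => k; rewrite !andbA; congr (_ && _ && _); rewrite andbC.
Qed.

Lemma far_isW u v w : isW u -> is_far u v -> adj u w -> adj v w -> isW v.
Proof. by move=> wu f uw vw; case: (types v) => // qv; case: (far_types wu qv f uw vw). Qed.

Lemma is_farC u v : is_far u v = is_far v u.
Proof. by rewrite /is_far eq_sym adjC. Qed.

Lemma exists_far x y z : adj x y -> adj x z -> exists w, [/\ adj x w, is_far y w & is_far z w].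
Proof.
move=> xy xz.
have [T [e [ch chk]]] : exists T e, chart T x e /\ chk_far T.
  case: (types x) => [] [e ch]; first by exists TW, e; split; [|exact: farW].
  by exists TQ, e; split; [|exact: farQ].
case: (ch) => eu _ surj _; have [i hi yE] := surj _ xy; have [j hj zE] := surj _ xz.
have [k hk /andP []] := chk_farP chk hi hj.
rewrite !(chart_far ch) // -yE -zE => /andP [a1 a2] /andP [b1 b2].
by exists (e k); rewrite eu // /is_far a2 b2 ![adj _ (e k)]adjC a1 b1.
Qed.

(** If y and z are adjacent, [far_isW] does not compare them directly. The type travels through a
    neighbour w of x that is far from both. *)
Lemma nbr_isW x y z : adj x y -> adj x z -> isW y -> isW z.
Proof.
move=> xy xz wy; have [w [xw yw zw]] := exists_far xy xz.
have ww : isW w by apply: (far_isW (w := x) wy yw); rewrite adjC.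
by apply: (far_isW ww (v := z) (w := x)); rewrite 1?adjC // is_farC.
Qed.

Lemma exists_nbr x y : adj x y -> exists2 z, adj x z & adj y z.
Proof.
move=> xy.
have [T [e [ch chk]]] : exists T e, chart T x e /\ chk_nbr T.
  case: (types x) => [] [e ch]; first by exists TW, e; split; [|exact: nbrW].
  by exists TQ, e; split; [|exact: nbrQ].
case: (ch) => eu _ surj ad; have [i hi yE] := surj _ xy.
have /all40P /(_ _ hi) := chk; rewrite lhasE => /hasP [j]; rewrite mem_iota => /= hj.
by rewrite -ad // -yE => yj; exists (e j); rewrite ?eu.
Qed.

(** With z a common neighbour, the type passes from x to z inside Γ(y), then from z to y inside
    Γ(x). *)
Lemma adj_isW x y : adj x y -> isW x -> isW y.
Proof.
move=> xy wx; have [z xz yz] := exists_nbr xy.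
apply: (nbr_isW xz xy); apply: (nbr_isW (x := y) _ yz wx); by rewrite adjC.
Qed.

Lemma agree_table T (P : bool -> nat -> bool) u e v v' i :
  wf_table T -> chart T u e -> i < 40 -> (exists e', chart T (e i) e') -> chk_agree T P ->
  is_far u v -> is_far u v' -> v != v' -> adj v (e i) -> adj v' (e i) ->
  P (adj v v') (cnt3 (prof e v) (prof e v') (nth [::] T i)).
Proof.
move=> wfT ch hi [e' ch'] /all40P chk fv fv' vv' vi vi'.
rewrite adjC in vi; rewrite adjC in vi'.
have [o [a [a' [[ho ha ha'] [uE vE vE'] ->]]]] := cnt3_trace wfT wfT ch hi ch' vi vi'.
case: (ch') => _ _ _ ad'.
have /all40P /(_ _ ha) := chk _ ho; rewrite (chart_far ch' ho ha) -uE -vE.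
move: fv fv'; rewrite /is_far ![_ == u]eq_sym => /andP [-> ->] /andP [f1 f2].
move=> /all40P /(_ _ ha'); rewrite (chart_far ch' ho ha') -uE -vE' f1 f2.
have -> : a != a' by apply: contraNneq vv' => aE; rewrite vE vE' aE.
by rewrite -ad' // -vE -vE'.
Qed.

(** * Not all neighbourhoods are of type Q_4(3) *)

Section AllQ.
Hypothesis allQ : forall u, isQ u.
Variables (u : V) (e : nat -> V).
Hypothesis ch : chart TQ u e.

Lemma compatQ_far v v' : is_far u v -> is_far u v' -> v != v' ->
  compatQ (prof e v) (prof e v').
Proof.
move=> fv fv' vv'; have [wfT _] := andP wfQ.
have h i (hi : i < 40) := agree_table wfT ch hi (allQ (e i)) agreeQ fv fv' vv'.
rewrite /compatQ; case: ifP => // /negP c1; case av: (adj v v') h => h.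
  by case: c1; apply: compatP.
exact: compatP.
Qed.

(** In the neighbourhood of the claw's centre, u is a common neighbour of the three ends; [clawQ]
    supplies another one, far from u. *)
Lemma claw_far w x y z : w < 40 -> x < 40 -> y < 40 -> z < 40 ->
  [&& tadj TQ w x, tadj TQ w y, tadj TQ w z, far TQ x y, far TQ x z & far TQ y z] ->
  exists2 v, is_far u v & [&& adj v (e w), adj v (e x), adj v (e y) & adj v (e z)].
Proof.
move=> hw hx hy hz; rewrite !(chart_far ch) //; case: (ch) => eu _ _ ad.
rewrite -!ad // => /and4P [wx wy wz /and3P [fxy fxz fyz]].
have [e' ch'] := allQ (e w); case: (ch') => eu' _ surj' ad'.
have wu : adj (e w) u by rewrite adjC eu.
have [o ho oE] := surj' _ wu; have [i hi iE] := surj' _ wx.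
have [j hj jE] := surj' _ wy; have [k hk kE] := surj' _ wz.
have [a ha] : exists2 a, a < 40 & [&& far TQ o a, tadj TQ i a, tadj TQ j a & tadj TQ k a].
  apply: (chk_clawP clawQ) => //.
    by rewrite -!ad' // -oE -iE -jE -kE !eu.
  by rewrite !(chart_far ch') // -iE -jE -kE fxy fxz.
case/and4P => foa ia ja ka.
exists (e' a); first by move: foa; rewrite (chart_far ch') // -oE /is_far eq_sym andbC.
rewrite -ad' // -iE in ia; rewrite -ad' // -jE in ja; rewrite -ad' // -kE in ka.
by rewrite ![adj (e' a) _]adjC ia ja ka eu'.
Qed.

(** A tree cannot refute hyperovals that come from vertices: the queried claw lies in the hyperoval
    of some v, this hyperoval passes the filter, and the corresponding child would refute the list
    extended by v. *)
Lemma refute_far t vs : (forall v, v \in vs -> is_far u v) ->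
  ~~ refute t (map (prof e) vs).
Proof.
elim/rtree_nested_ind: t vs => w x y z ts IH vs fvs; apply/negP; rewrite refuteE.
case/and4P => /and4P [hw hx hy hz] cl nc go.
have [v fv vq] := claw_far hw hx hy hz cl.
have cv : contains [:: w; x; y; z] (prof e v).
  by rewrite /contains lallE /= !nth_prof // andbT.
(* The claw lies in no chosen hyperoval, so v is a new vertex, and [compatQ_far] applies to it and
   each chosen one. *)
have vvs : v \notin vs.
  apply: contra nc => hv; apply/hasP; exists (prof e v) => //; exact: map_f.
have vH : prof e v \in HQ by apply: (hyperQ ch); case/andP: fv.
set ms := [seq m <- HQ | _] in go.
have {vH} vms : prof e v \in ms.
  rewrite mem_filter vH andbT cv lallE; apply/allP => m /mapP [v' hv' ->].
  apply: compatQ_far => //; first exact: fvs.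
  by apply: contraNneq vvs => ->.
elim: ts ms IH go vms => [|t ts IHts] [|m ms] // IH /andP [ht go].
rewrite inE => /orP [/eqP mE|]; last by apply: IHts => // t' ht'; apply: IH; right.
have fvs' v' : v' \in v :: vs -> is_far u v' by rewrite inE => /orP [/eqP ->|/fvs].
by have := IH t (or_introl erefl) (v :: vs) fvs'; rewrite map_cons mE ht.
Qed.

End AllQ.

Lemma not_allQ : V -> ~ forall u, isQ u.
Proof.
move=> u allQ; have [e ch] := allQ u.
have no v : v \in [::] -> is_far u v by rewrite in_nil.
by have /negP := refute_far allQ ch the_tree no; apply; exact: the_tree_refutes.
Qed.

End Local.

(** * All neighbourhoods of type W(3): small hyperovals and a tripartite frame *)

Section AllW.
Hypothesis allW : forall u, isW u.

Let types u : isW u \/ isQ u := or_introl (allW u).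

Lemma compatW_far u e v v' : chart TW u e -> is_far u v -> is_far u v' -> v != v' ->
  compat okW TW (prof e v) (prof e v').
Proof.
move=> ch fv fv' vv'; have [wfT _] := andP wfW.
by apply: compatP => // i hi; apply: (agree_table (P := fun=> okW) wfT ch hi (allW (e i)) agreeW).
Qed.

Lemma path_far u e w x y : chart TW u e -> w < 40 -> x < 40 -> y < 40 ->
  [&& tadj TW w x, tadj TW w y & far TW x y] ->
  exists2 v, is_far u v & [&& adj v (e w), adj v (e x) & adj v (e y)].
Proof.
move=> ch hw hx hy; rewrite !(chart_far ch) //; case: (ch) => eu _ _ ad.
rewrite -!ad // => /and3P [wx wy fxy].
have [e' ch'] := allW (e w); case: (ch') => eu' _ surj' ad'.
have wu : adj (e w) u by rewrite adjC eu.
have [o ho oE] := surj' _ wu; have [i hi iE] := surj' _ wx.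
have [j hj jE] := surj' _ wy.
have [a ha] : exists2 a, a < 40 & [&& far TW o a, tadj TW i a & tadj TW j a].
  apply: (chk_pathP pathW) => //.
  by rewrite -!ad' // (chart_far ch') // -oE -iE -jE !eu.
rewrite (chart_far ch') // -oE => /and3P [foa ia ja].
exists (e' a); first by move: foa; rewrite /is_far eq_sym andbC.
rewrite -ad' // -iE in ia; rewrite -ad' // -jE in ja.
by rewrite ![adj (e' a) _]adjC ia ja eu'.
Qed.

(** A larger hyperoval is killed by some query. [path_far] realises the query's path by a vertex v',
    which differs from v because the hyperoval of v misses the centre; the two hyperovals then have
    to be compatible, against the check. *)
Lemma small_far u e v : chart TW u e -> is_far u v -> small (prof e v).
Proof.
move=> ch fv; have /andP [vu nuv] := fv; have vH := hyperW types ch vu nuv.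
have := killP; rewrite /chk_kill lallE => /allP /(_ _ vH); case: ifP => // _.
rewrite lhasE => /hasP [qo]; rewrite /query_opts => /mapP [[[w x] y] hq ->].
rewrite [(w, x, y).1.1]/= [(w, x, y).1.2]/= [(w, x, y).2]/= => /killsP [nw hms].
have := queriesP; rewrite /chk_queries lallE => /allP /(_ _ hq).
case/and4P => hw hx hy cl; have [v' fv' /and3P [vw vx vy]] := path_far ch hw hx hy cl.
have /andP [vu' nuv'] := fv'; have vH' := hyperW types ch vu' nuv'.
have /hms /negP [] : prof e v' \in [seq m <- HW | contains [:: w; x; y] m].
  by rewrite mem_filter vH' andbT /contains lallE; apply/and4P; rewrite !nth_prof.
by apply: (compatW_far ch) => //; apply/eqP => vE; move: nw; rewrite vE nth_prof // vw.
Qed.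

Lemma K44_axiom u v p q x : is_far u v -> adj u p -> adj u q -> adj u x ->
  adj v p -> adj v q -> adj v x -> adj p q -> adj x p || adj x q.
Proof.
move=> fv up uq ux vp vq vx pq; have [e ch] := allW u.
have sm := small_far ch fv; have /andP [vu nuv] := fv; have vH := hyperW types ch vu nuv.
case: (ch) => eu _ surj ad; have [i hi iE] := surj _ up; have [j hj jE] := surj _ uq.
have [k hk kE] := surj _ ux.
have := K44P; rewrite /chk_K44 lallE => /allP /(_ _ vH); rewrite sm.
move=> /all40P /(_ _ hi); rewrite nth_prof // -iE vp => /all40P /(_ _ hj).
rewrite nth_prof // -jE vq -ad // -iE -jE pq => /all40P /(_ _ hk).
by rewrite nth_prof // -kE vx -!ad // -kE -iE -jE.
Qed.

Definition parity_axiom := forall a b b' l l' c x x' y y',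
  [&& adj a b, adj a b', adj a l, adj a l' & adj a c] ->
  [&& adj a x, adj a x', adj a y & adj a y'] ->
  [&& is_far b b', is_far l l', adj b l, adj b l', adj b' l & adj b' l'] ->
  [&& ~~ adj c b, ~~ adj c b', ~~ adj c l & ~~ adj c l'] ->
  [&& adj b x, adj l x & adj c x] -> [&& adj b' x', adj l' x' & adj c x'] ->
  [&& adj b y, adj l' y & adj c y] -> [&& adj b' y', adj l y' & adj c y'] ->
  adj x x' (+) adj y y'.

Lemma parity_axiomP : parity_axiom.
Proof.
move=> a b b' l l' c x x' y y' /and5P [ab ab' al al' ac] /and4P [ax ax' ay ay'].
case/and4P => fb fl bl /and3P [bl' b'l b'l'] /and4P [cb cb' cl cl'].
move=> /and3P [bx lx cx] /and3P [bx' lx' cx'] /and3P [by_ ly cy] /and3P [by' ly' cy'].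
have [e ch] := allW a; case: (ch) => eu inj surj ad.
have [ib hb bE] := surj _ ab; have [ib' hb' bE'] := surj _ ab'.
have [il hl lE] := surj _ al; have [il' hl' lE'] := surj _ al'.
have [ic hc cE] := surj _ ac; have [ix hx xE] := surj _ ax; have [ix' hx' xE'] := surj _ ax'.
have [iy hy yE] := surj _ ay; have [iy' hy' yE'] := surj _ ay'.
have farE i j : i < 40 -> j < 40 -> far TW i j = is_far (e i) (e j).
  by move=> hi hj; rewrite (chart_far ch) // /is_far eq_sym andbC.
(* The table was checked for b < b' and l < l' only. Exchanging l and l' swaps the pairs x, x' and
   y, y'; exchanging b and b' swaps and reverses them. *)
have aux jb jb' jl jl' jx jx' jy jy' :
  [&& jb < 40, jb' < 40, jl < 40, jl' < 40, jx < 40, jx' < 40, jy < 40 & jy' < 40] ->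
  is_far (e jb) (e jb') -> jb < jb' -> jl < jl' ->
  [&& adj (e jb) (e jl), adj (e jb) (e jl'), adj (e jb') (e jl) & adj (e jb') (e jl')] ->
  [&& ~~ adj c (e jb), ~~ adj c (e jb'), ~~ adj c (e jl) & ~~ adj c (e jl')] ->
  [&& adj (e jb) (e jx), adj (e jl) (e jx) & adj c (e jx)] ->
  [&& adj (e jb') (e jx'), adj (e jl') (e jx') & adj c (e jx')] ->
  [&& adj (e jb) (e jy), adj (e jl') (e jy) & adj c (e jy)] ->
  [&& adj (e jb') (e jy'), adj (e jl) (e jy') & adj c (e jy')] ->
  adj (e jx) (e jx') (+) adj (e jy) (e jy').
  case/and4P => gb gb' gl /and5P [gl' gx gx' gy gy'] fbb ltb ltl.
  case/and4P => h1 h2 h3 h4 /and4P [n1 n2 n3 n4].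
  move=> /and3P [p1 p2 p3] /and3P [q1 q2 q3] /and3P [r1 r2 r3] /and3P [s1 s2 s3].
  have := parityP; rewrite /chk_parity => /all40P /(_ _ gb) /all40P /(_ _ gb').
  rewrite farE // fbb ltb; cbv zeta; rewrite lallE => /allP /(_ jl).
  rewrite mem_common2 gl -!ad // h1 h3 => /(_ isT); rewrite lallE => /allP /(_ jl').
  rewrite mem_common2 gl' -!ad // h2 h4 ltl => /(_ isT) /all40P /(_ _ hc).
  rewrite -!ad // -cE (negPf n1) (negPf n2) (negPf n3) (negPf n4) lallE => /allP /(_ jx).
  rewrite mem_common2 gx -!ad // p1 p2 -/(tadj TW ic jx) -ad // -cE p3 => /(_ isT).
  rewrite lallE => /allP /(_ jx').
  rewrite mem_common2 gx' -!ad // q1 q2 -/(tadj TW ic jx') -ad // -cE q3 => /(_ isT).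
  rewrite lallE => /allP /(_ jy).
  rewrite mem_common2 gy -!ad // r1 r2 -/(tadj TW ic jy) -ad // -cE r3 => /(_ isT).
  rewrite lallE => /allP /(_ jy').
  by rewrite mem_common2 gy' -!ad // s1 s2 -/(tadj TW ic jy') -ad // -cE s3 => /(_ isT).
have fb' : is_far b' b by rewrite is_farC.
rewrite bE bE' lE lE' xE xE' yE yE' in fb fb' fl bl bl' b'l b'l' cb cb' cl cl'
  bx lx cx bx' lx' cx' by_ ly cy by' ly' cy' *.
have R := (hb, hb', hl, hl', hx, hx', hy, hy', (bl, bl', b'l, b'l', (cb, cb', cl, cl')),
  (bx, lx, cx, (bx', lx', cx')), (by_, ly, cy, (by', ly', cy'))).
have ltb : ib != ib' by apply: contraTneq fb => ->; rewrite /is_far eqxx.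
have ltl : il != il' by apply: contraTneq fl => ->; rewrite /is_far eqxx.
case: (ltngtP ib ib') ltb => // hbb _; case: (ltngtP il il') ltl => // hll _.
- by apply: (aux ib ib' il il'); rewrite ?R.
- by rewrite addbC; apply: (aux ib ib' il' il); rewrite ?R.
- by rewrite addbC [adj (e ix) _]adjC [adj (e iy) _]adjC;
  apply: (aux ib' ib il il'); rewrite ?R.
- by rewrite [adj (e ix) _]adjC [adj (e iy) _]adjC;
  apply: (aux ib' ib il' il); rewrite ?R.
Qed.

Definition K444 (A B L : nat -> V) : Prop :=
  (forall i j, i < 4 -> j < 4 -> [&& adj (A i) (B j), adj (A i) (L j) & adj (B i) (L j)]) /\
  (forall i j, i < 4 -> j < 4 -> i != j ->
     [&& is_far (A i) (A j), is_far (B i) (B j) & is_far (L i) (L j)]).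

(** Start from [PA] and [PB] in Γ(u), and let [L] be the common neighbours of [B 0] and [B 1] inside
    Γ(A 0). One of them is u. Any other is far from u and its hyperoval contains [A 0], [B 0],
    [B 1], so by [frameP] it contains all of [A] and [B]. *)
Lemma K444_exists : V -> exists A B L, K444 A B L.
Proof.
move=> u; have [e ch] := allW u; case: (ch) => eu inj surj ad.
have farE T v f i j : chart T v f -> i < 40 -> j < 40 -> far T i j = is_far (f i) (f j).
  by move=> chf hi hj; rewrite (chart_far chf) // /is_far eq_sym andbC.
have := PABP; rewrite /chk_PAB => /and4P [hlt hadj hA hB].
have lA i : i < 4 -> nth 0 PA i < 40.
  by move=> hi; apply: (allP hlt); rewrite mem_cat mem_nth.
have lB i : i < 4 -> nth 0 PB i < 40.
  by move=> hi; apply: (allP hlt); rewrite mem_cat orbC mem_nth.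
pose A i := e (nth 0 PA i); pose B i := e (nth 0 PB i).
have AB i j : i < 4 -> j < 4 -> adj (A i) (B j).
  move=> hi hj; rewrite ad ?lA ?lB //.
  by apply: (allP (allP hadj _ _)); rewrite mem_nth.
have farA i j : i < 4 -> j < 4 -> i != j -> is_far (A i) (A j).
  move=> hi hj ij; rewrite -(farE _ _ _ _ _ ch) ?lA //.
  have /allP /(_ i) := hA; rewrite mem_iota hi => /(_ isT) /allP /(_ j).
  by rewrite mem_iota hj (negPf ij) => /(_ isT).
have farB i j : i < 4 -> j < 4 -> i != j -> is_far (B i) (B j).
  move=> hi hj ij; rewrite -(farE _ _ _ _ _ ch) ?lB //.
  have /allP /(_ i) := hB; rewrite mem_iota hi => /(_ isT) /allP /(_ j).
  by rewrite mem_iota hj (negPf ij) => /(_ isT).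
have [e' ch'] := allW (A 0); case: (ch') => eu' inj' surj' ad'.
have [b0 hb0 b0E] := surj' _ (AB 0 0 isT isT); have [b1 hb1 b1E] := surj' _ (AB 0 1 isT isT).
have fb : far TW b0 b1 by rewrite (farE _ _ _ _ _ ch') // -b0E -b1E farB.
have := perpP; rewrite /chk_perp => /all40P /(_ _ hb0) /all40P /(_ _ hb1); rewrite fb.
case cE: (common2 TW b0 b1) => [|c0 [|c1 [|c2' [|c3 []]]]] // hc.
pose cs := [:: c0; c1; c2'; c3].
have mem m : m \in cs -> [/\ m < 40, adj (B 0) (e' m) & adj (B 1) (e' m)].
  rewrite /cs -cE mem_common2 => /and3P [hm]; rewrite -!ad' // -b0E -b1E => h1 h2.
  by rewrite hm h1 h2.
have csl i : i < 4 -> nth 0 cs i \in cs by move=> hi; rewrite mem_nth.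
pose L i := e' (nth 0 cs i).
have farL i j : i < 4 -> j < 4 -> i != j -> is_far (L i) (L j).
  have h i' j' : i' < j' -> j' < 4 -> is_far (L i') (L j').
    move=> ij hj; have hi := ltn_trans ij hj.
    have [l1 _ _] := mem _ (csl _ hi); have [l2 _ _] := mem _ (csl _ hj).
    rewrite -(farE _ _ _ _ _ ch') //.
    move: hc ij hi hj; case/and4P => f01 f02 f03 /and3P [f12 f13 f23].
    by case: i' l1 => [|[|[|[]]]] //; case: j' l2 => [|[|[|[]]]].
  move=> hi hj; case: (ltngtP i j) => // ij _; first exact: h.
  by rewrite is_farC; apply: h.
have A0L i : i < 4 -> adj (A 0) (L i).
  by move=> hi; apply: eu'; case: (mem _ (csl _ hi)).
have main i k : i < 4 -> k < 4 -> adj (L k) (A i) && adj (L k) (B i).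
  move=> hi hk; have [hLk B0 B1] := mem _ (csl _ hk); rewrite -/(L k) in B0 B1.
  have [->|Lu] := eqVneq (L k) u; first by rewrite !eu ?lA ?lB.
  have fu : is_far u (L k).
    (* Since u sees [A 0], [B 0] and [B 1], it is itself one of the [L], and the others are far from
       it. *)
    have uc : exists2 k', k' < 4 & u = L k'.
      have [o ho oE] : exists2 o, o < 40 & u = e' o by apply: surj'; rewrite adjC eu ?lA.
      have oc : o \in cs.
        rewrite /cs -cE mem_common2 ho -!ad' // -oE -b0E -b1E !(adjC _ u).
        by rewrite !eu ?lB.
      exists (index o cs); first by rewrite index_mem in oc *.
      by rewrite /L nth_index.
    case: uc => k' hk' uE; rewrite uE; apply: farL => //.
    by apply: contraNneq Lu => <-; rewrite uE.
  have sm := small_far ch fu; have /andP [vu nuv] := fu; have vH := hyperW types ch vu nuv.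
  have := frameP; rewrite /chk_frame lallE => /allP /(_ _ vH); rewrite sm.
  have -> : contains [:: 32; 33; 34] (prof e (L k)).
    have [h1 h2] := (lB 0 isT, lB 1 isT); have h0 := lA 0 isT.
    rewrite /contains lallE; apply/and4P; split => //; rewrite nth_prof //.
    - by rewrite adjC; apply: A0L.
    - by rewrite adjC.
    - by rewrite adjC.
  rewrite /contains lallE => /allP h.
  have hA' : nth false (prof e (L k)) (nth 0 PA i) by apply: h; rewrite mem_cat mem_nth.
  have hB' : nth false (prof e (L k)) (nth 0 PB i) by apply: h; rewrite mem_cat orbC mem_nth.
  by move: hA' hB'; rewrite !nth_prof ?lA ?lB // => -> ->.
exists A, B, L; split => i j hi hj => [|ij]; last by rewrite farA // farB // farL.
have /andP [h1 h2] := main _ _ hi hj.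
by rewrite AB // adjC h1 adjC h2.
Qed.

End AllW.
End Graph.

(** * The target graph U_5 *)

(** GF(4) is coded by 0, 1, 2, 3 for 0, 1, a, a^2, where a^2 = a + 1. *)
Definition mul4 a b := nth 0 (nth [::]
  [:: [:: 0; 0; 0; 0]; [:: 0; 1; 2; 3]; [:: 0; 2; 3; 1]; [:: 0; 3; 1; 2]] a) b.
Definition add4 a b := nth 0 (nth [::]
  [:: [:: 0; 1; 2; 3]; [:: 1; 0; 3; 2]; [:: 2; 3; 0; 1]; [:: 3; 2; 1; 0]] a) b.
Definition hermn (x y : seq nat) :=
  foldr add4 0 [seq mul4 p.1 (mul4 p.2 p.2) | p <- zip x y].

(* The points of U_5 in the order A, B, L (0..11), the two vertices of cell c
   (12 + 2 c and 13 + 2 c, with c = 16 i + 4 j + k), and the remaining 36. *)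
Definition ptsU : seq (seq nat) := Eval vm_compute in map (digits 4 5)
  [:: 4; 88; 84; 92; 256; 336; 416; 496; 1; 81; 82; 83; 16; 64; 99; 114; 97; 115; 98;
      113; 432; 480; 273; 321; 274; 322; 275; 323; 368; 464; 290; 386; 291; 387; 289;
      385; 352; 400; 307; 451; 305; 449; 306; 450; 100; 124; 25; 73; 26; 74; 27; 75;
      280; 328; 441; 489; 442; 490; 443; 491; 300; 396; 382; 478; 383; 479; 381; 477;
      308; 452; 359; 407; 357; 405; 358; 406; 108; 120; 21; 69; 22; 70; 23; 71; 276;
      324; 437; 485; 438; 486; 439; 487; 296; 392; 378; 474; 379; 475; 377; 473; 316;
      460; 367; 415; 365; 413; 366; 414; 104; 116; 29; 77; 30; 78; 31; 79; 284; 332;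
      445; 493; 446; 494; 447; 495; 292; 388; 374; 470; 375; 471; 373; 469; 312; 456;
      363; 411; 361; 409; 362; 410; 261; 262; 263; 265; 266; 267; 269; 270; 271; 341;
      342; 343; 345; 346; 347; 349; 350; 351; 421; 422; 423; 425; 426; 427; 429; 430;
      431; 501; 502; 503; 505; 506; 507; 509; 510; 511].

Definition GU : seq bitseq := Eval vm_compute in mktable hermn ptsU.
Lemma GUE : mktable hermn ptsU = GU.
Proof. by vm_cast_no_check (erefl GU). Qed.

Definition gadj n m := nth false (nth [::] GU n) m.
(** The signs of U_5, read at the even-numbered vertex of each cell, which corresponds to [false] in
    [X i j k false]. *)
Definition Ms c d := gadj (12 + c.*2) (12 + d.*2).

Definition cell i j k := i * 16 + j * 4 + k.
Definition axcell t a p q :=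
  match t with 0 => cell a p q | 1 => cell p a q | _ => cell p q a end.
Definition ed (c d : nat) := if c < d then (c, d) else (d, c).

(** * The linear system over F_2 satisfied by the signs *)

Fixpoint words n : seq (seq nat) :=
  if n is m.+1 then [seq x :: w | x <- iota 0 4, w <- words m] else [:: [::]].

Definition star_good t := if t is [:: i; i'; j; j'; k; k'] then
  [&& all (gtn 4) t, i != i', j != j' & k != k'] else false.
Definition star_eq t := if t is [:: i; i'; j; j'; k; k'] then
  ([:: ed (cell i j k) (cell i j' k'); ed (cell i j k) (cell i' j k');
       ed (cell i j' k') (cell i' j k')], true) else ([::], false).

Definition line_good t := if t is [:: x; a; j; j1; j2; j3; k; k1; k2; k3] then
  [&& x < 3, a < 4, all (gtn 4) [:: j; j1; j2; j3], all (gtn 4) [:: k; k1; k2; k3],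
      uniq [:: j; j1; j2; j3] & uniq [:: k; k1; k2; k3]] else false.
Definition line_eq t := if t is [:: x; a; j; j1; j2; j3; k; k1; k2; k3] then
  ([:: ed (axcell x a j k) (axcell x a j2 k2); ed (axcell x a j1 k1) (axcell x a j2 k2);
       ed (axcell x a j k) (axcell x a j3 k3); ed (axcell x a j1 k1) (axcell x a j3 k3)], false)
  else ([::], false).

Definition parity_good t := if t is [:: x; a; j; j1; j2; k; k1; k2] then
  [&& x < 3, a < 4, all (gtn 4) [:: j; j1; j2], all (gtn 4) [:: k; k1; k2],
      uniq [:: j; j1; j2] & uniq [:: k; k1; k2]] else false.
Definition parity_eq t := if t is [:: x; a; j; j1; j2; k; k1; k2] then
  ([:: ed (axcell x a j k) (axcell x a j1 k1); ed (axcell x a j k) (axcell x a j2 k2);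
       ed (axcell x a j1 k1) (axcell x a j2 k2);
       ed (axcell x a j k1) (axcell x a j1 k); ed (axcell x a j k1) (axcell x a j2 k2);
       ed (axcell x a j1 k) (axcell x a j2 k2)], true)
  else ([::], false).

(** These two values are chosen, not derived: permuting indices preserves the other equations, while
    the transposition of 1 and 2 flips the first sum when made in [L], and the second alone when
    made in [A]. *)
Definition norm_eqs :=
  [:: ([:: ed (cell 0 0 0) (cell 0 1 1); ed (cell 0 0 0) (cell 0 2 2);
           ed (cell 0 1 1) (cell 0 2 2)], true);
      ([:: ed (cell 0 0 0) (cell 1 0 1); ed (cell 0 0 0) (cell 2 0 2);
           ed (cell 1 0 1) (cell 2 0 2)], true)].

Definition perms4 := [seq w <- words 4 | uniq w].
Definition perms3 := [seq w <- words 3 | uniq w].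
Definition line_idx := [seq x :: w | x <- iota 0 3, w <- [seq a :: pq | a <- iota 0 4, pq <-
  [seq p ++ q | p <- [seq p <- perms4 | (nth 0 p 0 < nth 0 p 1) && (nth 0 p 2 < nth 0 p 3)],
                q <- perms4]]].
Definition parity_idx := [seq x :: w | x <- iota 0 3, w <- [seq a :: pq | a <- iota 0 4, pq <-
  [seq p ++ q | p <- [seq p <- perms3 | nth 0 p 0 < nth 0 p 1],
                q <- [seq q <- perms3 | nth 0 q 0 < nth 0 q 1]]]].

Definition eqs : seq (seq (nat * nat) * bool) :=
  norm_eqs ++ [seq star_eq t | t <- words 6 & star_good t]
  ++ [seq line_eq t | t <- line_idx & line_good t]
  ++ [seq parity_eq t | t <- parity_idx & parity_good t].

Definition esum (M : nat -> nat -> bool) (l : seq (nat * nat)) :=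
  foldr addb false [seq M p.1 p.2 | p <- l].

Lemma eqs_target : all (fun e => esum Ms e.1 == e.2) eqs.
Proof. by vm_cast_no_check isT. Qed.

Definition known (K : seq bitseq) (e : nat * nat) := nth false (nth [::] K e.1) e.2.
Definition set_known (K : seq bitseq) (e : nat * nat) :=
  set_nth [::] K e.1 (set_nth false (nth [::] K e.1) e.2 true).
(** Unit propagation for the difference between the signs and those of U_5. The right-hand sides
    cancel in the difference, so an equation with one unknown edge forces it to be zero. *)
Definition propagate (K : seq bitseq) (l : seq (nat * nat)) :=
  if [seq e <- l | ~~ known K e] is [:: e] then set_known K e else K.

(* A spanning tree of the graph of cells as pairs (child, parent), leaves first. *)
Definition tree_edges : seq (nat * nat) :=
  [:: (16, 33); (48, 17); (32, 17); (4, 9); (63, 7); (59, 7); (47, 7); (43, 7);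
      (31, 7); (27, 7); (62, 6); (58, 6); (53, 6); (46, 6); (42, 6); (37, 6);
      (30, 6); (26, 6); (21, 6); (1, 6); (61, 5); (57, 5); (55, 5); (54, 5); (45, 5);
      (41, 5); (39, 5); (38, 5); (29, 5); (25, 5); (23, 5); (22, 5); (12, 5); (8, 5);
      (3, 5); (2, 5); (60, 0); (56, 0); (52, 0); (51, 0); (50, 0); (49, 0); (44, 0);
      (40, 0); (36, 0); (35, 0); (34, 0); (33, 0); (28, 0); (24, 0); (20, 0);
      (19, 0); (18, 0); (17, 0); (15, 0); (14, 0); (13, 0); (11, 0); (10, 0); (9, 0);
      (7, 0); (6, 0); (5, 0)].

(** A child does not occur in any later edge, so its value can be set freely once the later edges
    are satisfied; this drives [tree_gauge]. *)
Fixpoint fresh_tree (te : seq (nat * nat)) := if te is (c, p) :: te' then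
  [&& c != p, all (fun e => (e.1 != c) && (e.2 != c)) te' & fresh_tree te'] else true.
Lemma fresh_treeP : fresh_tree tree_edges. Proof. by []. Qed.

Definition known0 := foldl set_known (nseq 64 (nseq 64 false)) [seq ed e.1 e.2 | e <- tree_edges].
Definition pass K := foldl (fun K e => propagate K e.1) K eqs.
Definition known_final := pass (pass (pass (pass known0))).

Definition coord t c := match t with 0 => c %/ 16 | 1 => c %/ 4 %% 4 | _ => c %% 4 end.
Definition ncommon c d :=
  (coord 0 c == coord 0 d) + (coord 1 c == coord 1 d) + (coord 2 c == coord 2 d).

Definition chk_closure := let K := known_final in
  lall (fun c => lall (fun d => if c < d then
    if ncommon c d == 1 then known K (c, d) else true else true) (iota 0 64)) (iota 0 64).
Lemma closureP : chk_closure. Proof. by vm_cast_no_check isT. Qed.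

Lemma known_set K e e' : known (set_known K e) e' -> e' = e \/ known K e'.
Proof.
case: e e' => [c d] [c' d']; rewrite /known /set_known nth_set_nth /=.
case: eqP => [->|_]; last by right.
by rewrite nth_set_nth /=; case: eqP => [->|_]; [left|right].
Qed.

Section Propagation.
Variable n : nat -> nat -> bool.
Definition zero_on K := forall e, known K e -> n e.1 e.2 = false.

Lemma zero_on_set K e : zero_on K -> n e.1 e.2 = false -> zero_on (set_known K e).
Proof. by move=> h h0 e' /known_set [->|/h]. Qed.

Lemma esum_split K l : zero_on K -> esum n l = esum n [seq e <- l | ~~ known K e].
Proof.
move=> h; rewrite /esum; elim: l => //= e l ->.
by case: (boolP (known K e)) => //= /h ->.
Qed.

Lemma propagate_zero K l : zero_on K -> esum n l = false -> zero_on (propagate K l).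
Proof.
move=> h; rewrite (esum_split _ h) /propagate; case: [seq _ <- _ | _] => [|e []] //.
by rewrite /esum /= addbF; apply: zero_on_set.
Qed.

Lemma foldl_zero K (l : seq (seq (nat * nat) * bool)) :
  zero_on K -> (forall e, e \in l -> esum n e.1 = false) ->
  zero_on (foldl (fun K e => propagate K e.1) K l).
Proof.
elim: l K => //= e l IH K hK h; apply: IH.
  by apply: propagate_zero => //; apply: h; rewrite mem_head.
by move=> e' he'; apply: h; rewrite inE he' orbT.
Qed.

Lemma zero_on_nil : zero_on (nseq 64 (nseq 64 false)).
Proof.
move=> e; suff -> : known (nseq 64 (nseq 64 false)) e = false by [].
by rewrite /known nth_nseq; case: ifP => _; rewrite ?nth_nil // nth_nseq if_same.
Qed.

Lemma foldl_set_zero K l : zero_on K -> (forall e, e \in l -> n e.1 e.2 = false) ->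
  zero_on (foldl set_known K l).
Proof.
elim: l K => //= e l IH K hK h; apply: IH.
  by apply: zero_on_set => //; apply: h; rewrite mem_head.
by move=> e' he'; apply: h; rewrite inE he' orbT.
Qed.

Hypothesis ntree : forall e, e \in tree_edges -> n (ed e.1 e.2).1 (ed e.1 e.2).2 = false.
Hypothesis neqs : forall e, e \in eqs -> esum n e.1 = false.

Lemma n_zero c d : c < 64 -> d < 64 -> c < d -> ncommon c d = 1 -> n c d = false.
Proof.
move=> hc hd cd cn.
have z : zero_on known_final.
  rewrite /known_final /pass; do 4 (apply: foldl_zero => //).
  apply: foldl_set_zero; first exact: zero_on_nil.
  by move=> e /mapP [e' /ntree h ->].
have := closureP; rewrite /chk_closure; cbv zeta; rewrite lallE => /allP /(_ c).
rewrite mem_iota hc => /(_ isT); rewrite lallE => /allP /(_ d).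
by rewrite mem_iota hd cd cn eqxx => /(_ isT) /z.
Qed.
End Propagation.

Lemma tree_gauge (te : seq (nat * nat)) (a : nat -> nat -> bool) : fresh_tree te ->
  exists lam : nat -> bool, forall e, e \in te -> lam e.1 (+) lam e.2 = a e.1 e.2.
Proof.
elim: te => [|[c p] te IH] /=; first by exists (fun=> false).
case/and3P => cp /allP fr /IH [lam h].
exists (fun x => if x == c then lam p (+) a c p else lam x) => e.
rewrite inE => /orP [/eqP -> /=|he].
  by rewrite eqxx eq_sym (negPf cp) addbAC addbb.
by have /andP [/negPf -> /negPf ->] := fr _ he; apply: h.
Qed.

Definition chk_tree := all (fun e => [&& e.1 < 64, e.2 < 64 & ncommon e.1 e.2 == 1]) tree_edges.
Lemma treeP : chk_tree. Proof. by vm_cast_no_check isT. Qed.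

Definition chk_symU := lall (fun c => lall (fun d => Ms c d == Ms d c) (iota 0 64)) (iota 0 64).
Lemma symUP : chk_symU. Proof. by vm_cast_no_check isT. Qed.

Lemma Ms_sym c d : c < 64 -> d < 64 -> Ms c d = Ms d c.
Proof.
move=> hc hd; have := symUP; rewrite /chk_symU lallE => /allP /(_ c).
rewrite mem_iota hc => /(_ isT); rewrite lallE => /allP /(_ d).
by rewrite mem_iota hd => /(_ isT) /eqP.
Qed.

Lemma coord_lt t c : c < 64 -> coord t c < 4.
Proof.
move=> hc; case: t => [|[|t]]; rewrite /coord ?ltn_mod //.
by rewrite ltn_divLR.
Qed.

Lemma cell_coord c : cell (coord 0 c) (coord 1 c) (coord 2 c) = c.
Proof.
rewrite /cell /coord -[16]/(4 * 4) divnMA mulnA -mulnDl.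
by rewrite -divn_eq -divn_eq.
Qed.

(** The adjacency of the 12 + 128 vertices dictated by the cell indices and the signs [M]. The same
    formula holds in U_5, by [patP], and in Γ, by [adj_f0]. *)
Definition pat M n m :=
  if n < 12 then if m < 12 then n %/ 4 != m %/ 4
                 else coord (n %/ 4) (m - 12)./2 == n %% 4
  else if m < 12 then coord (m %/ 4) (n - 12)./2 == m %% 4
  else let c := (n - 12)./2 in let d := (m - 12)./2 in
       if c == d then odd n != odd m
       else if ncommon c d == 1 then M c d (+) odd n (+) odd m else false.

Definition all_lt N (P : nat -> bool) := lall P (iota 0 N).
Lemma all_ltP N (P : nat -> bool) n : all_lt N P -> n < N -> P n.
Proof. by rewrite /all_lt lallE => /allP h hn; apply: h; rewrite mem_iota. Qed.

Definition chk_pat := all_lt 140 (fun n => let r := nth [::] GU n in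
  all_lt 140 (fun m => nth false r m == pat Ms n m)).
Lemma patP : chk_pat. Proof. by vm_cast_no_check isT. Qed.

(** * Checks that locate the last 36 vertices of U_5 *)

Definition Xnames := iota 12 128.
Definition Ynames := iota 140 36.

(** Four cell vertices forming a 5-clique with y; [r] collects the two that complete y, [x1],
    [x2]. *)
Definition pick_clique y :=
  let X := [seq n <- Xnames | gadj y n] in
  let x1 := head 0 X in
  let x2 := head 0 [seq n <- X | gadj x1 n && (n./2 != x1./2)] in
  let r := [seq n <- X | gadj x1 n && gadj x2 n] in
  [:: x1; x2; nth 0 r 0; nth 0 r 1].
Definition clique_list := Eval vm_compute in [seq pick_clique y | y <- Ynames].
Definition clq y := nth [::] clique_list (y - 140).

Definition is_clique p q r s := [&& gadj p q, gadj p r, gadj p s, gadj q r, gadj q s & gadj r s].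
Definition clique_of (l : seq nat) := if l is [:: p; q; r; s] then
  [&& [&& p < 140, q < 140, r < 140 & s < 140] & is_clique p q r s] else false.
Definition twin n := if odd n then n.-1 else n.+1.
Definition only1 x p q r s :=
  [&& gadj x p, ~~ gadj x q, ~~ gadj x r & ~~ gadj x s].
(** By [gq_axiom], a vertex outside a 5-clique that sees exactly one of four of its vertices must
    see the fifth. *)
Definition sees_one x (l : seq nat) := if l is [:: p; q; r; s] then
  [|| only1 x p q r s, only1 x q p r s, only1 x r p q s | only1 x s p q r] else false.

(** The twins each see one vertex of the clique, so its fifth vertex sees them as well and also
    completes their 4-clique. The last condition shows that this fifth vertex is not among the first
    140. *)
Definition chk_clq := lall (fun y => [&& clique_of (clq y), clique_of (map twin (clq y)),
  all (fun t => sees_one t (clq y) && (t \notin clq y)) (map twin (clq y)) &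
  lall (fun n => ~~ all (gadj n) (clq y)) (iota 0 140)]) Ynames.
Lemma clqP : chk_clq. Proof. by vm_cast_no_check isT. Qed.

Definition chk_edge := lall (fun y => let l := clq y in let l' := map twin l in
  all_lt 140 (fun x => if gadj y x then if x \in l then true else if sees_one x l then true
    else if x \in l' then true else sees_one x l' else true)) Ynames.
Lemma edgeP : chk_edge. Proof. by vm_cast_no_check isT. Qed.

Fixpoint idx3 n i (a b c : bitseq) : seq nat :=
  match n, a, b, c with
  | n'.+1, x :: a', y :: b', z :: c' =>
      if x then if y then if z then i :: idx3 n' i.+1 a' b' c' else idx3 n' i.+1 a' b' c'
                else idx3 n' i.+1 a' b' c' else idx3 n' i.+1 a' b' c'
  | _, _, _, _ => [::]
  end.

Definition full_clique z x q s t := [&& [&& s < 140 & t < 140],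
  [&& gadj z x, gadj z q, gadj z s & gadj z t], [&& gadj x q, gadj x s & gadj x t],
  gadj q s, gadj q t & gadj s t].

(** Two neighbours z, q of y and the non-neighbour x lie in a 5-clique of old vertices. If y saw x
    too, it would see three of its vertices and hence be one of the other two. *)
Definition chk_nonedge := lall (fun y => let N := [seq z <- Xnames | gadj y z] in
  lall (fun x => if gadj y x then true else let rx := nth [::] GU x in
    lhas (fun z => if nth false rx z then let rz := nth [::] GU z in
      lhas (fun q => if nth false rx q then if nth false rz q then
        if idx3 140 0 rx rz (nth [::] GU q) is [:: s; t] then full_clique z x q s t
        else false else false else false) N
      else false) N) Xnames) Ynames.
Lemma nonedgeP : chk_nonedge. Proof. by vm_cast_no_check isT. Qed.

Definition chk_YY := lall (fun y => lall (fun y' =>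
  if gadj y y' then sees_one y' (clq y) else true) Ynames) Ynames.
Lemma YYP : chk_YY. Proof. by vm_cast_no_check isT. Qed.

Definition chk_distY := lall (fun y => lall (fun y' => if y == y' then true else
  lhas (fun x => if gadj y x then ~~ gadj y' x else false) Xnames) Ynames) Ynames.
Lemma distYP : chk_distY. Proof. by vm_cast_no_check isT. Qed.

Definition chk_inj := all_lt 140 (fun n => all_lt 140 (fun m => if n == m then true else
  if gadj n m then true else lhas (fun z => gadj n z != gadj m z) (iota 0 140))).
Lemma injP : chk_inj. Proof. by vm_cast_no_check isT. Qed.

Definition chk_degree := all_lt 176 (fun n =>
  (count (gadj n) (iota 0 176) == 40) && all_lt 176 (fun m => gadj n m == gadj m n)).
Lemma degreeP : chk_degree. Proof. by vm_cast_no_check isT. Qed.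

(** * Frames and cells *)

Section Frame.
Variables (V : eqType) (adj : rel V).
Hypothesis adjC : symmetric adj.
Hypothesis adjxx : irreflexive adj.
Hypothesis tri : triangle_axiom adj.
Hypothesis gq : gq_axiom adj.
Hypothesis K44 : forall u v p q x, is_far adj u v -> adj u p -> adj u q -> adj u x ->
  adj v p -> adj v q -> adj v x -> adj p q -> adj x p || adj x q.
Hypothesis parity : parity_axiom adj.

Local Notation cl5 := (clique5 adj).
Local Notation "x ~ y" := (adj x y) (at level 70).

Definition frame (A B L : nat -> V) (X : nat -> nat -> nat -> bool -> V) : Prop :=
  K444 adj A B L /\ forall i j k, i < 4 -> j < 4 -> k < 4 ->
  [/\ adj (X i j k false) (X i j k true),
      forall s, [&& adj (A i) (X i j k s), adj (B j) (X i j k s) & adj (L k) (X i j k s)] &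
      forall y, adj (A i) y -> adj (B j) y -> adj (L k) y -> exists s, y = X i j k s].

(** The parts play the same role. Each adjacency rule is proved for one choice of parts and carried
    over by this symmetry and [frame_swap23]. *)
Lemma frame_swap12 A B L X : frame A B L X -> frame B A L (fun j i k => X i j k).
Proof.
move=> [[h1 h2] hX]; split; first split=> i j hi hj => [|ij].
- have /and3P [_ -> ->] := h1 _ _ hi hj; have /and3P [] := h1 _ _ hj hi.
  by rewrite adjC => ->.
- by have /and3P [-> -> ->] := h2 _ _ hi hj ij.
move=> j i k hj hi hk; have [h3 h4 h5] := hX _ _ _ hi hj hk; split=> // [s|y a b c].
  by have /and3P [-> -> ->] := h4 s.
exact: h5.
Qed.

Lemma frame_swap23 A B L X : frame A B L X -> frame A L B (fun i k j => X i j k).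
Proof.
move=> [[h1 h2] hX]; split; first split=> i j hi hj => [|ij].
- have /and3P [-> -> _] := h1 _ _ hi hj; have /and3P [_ _] := h1 _ _ hj hi.
  by rewrite adjC => ->.
- by have /and3P [-> -> ->] := h2 _ _ hi hj ij.
move=> i k j hi hk hj; have [h3 h4 h5] := hX _ _ _ hi hj hk; split=> // [s|y a b c].
  by have /and3P [-> -> ->] := h4 s.
exact: h5.
Qed.

Lemma far_nadj x y : is_far adj x y -> ~~ (x ~ y). Proof. by case/andP. Qed.
Lemma far_neq x y : is_far adj x y -> x != y. Proof. by case/andP; rewrite eq_sym. Qed.

Lemma frame_adj A B L X i j : frame A B L X -> i < 4 -> j < 4 ->
  [/\ A i ~ B j, A i ~ L j & B i ~ L j].
Proof. by move=> [[h _] _] hi hj; apply/and3P; apply: h. Qed.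

Lemma frame_farA A B L X i j : frame A B L X -> i < 4 -> j < 4 -> i != j ->
  is_far adj (A i) (A j).
Proof. by move=> [[_ h] _] hi hj ij; have /and3P [] := h _ _ hi hj ij. Qed.

Lemma cell_clique A B L X i j k s : frame A B L X -> i < 4 -> j < 4 -> k < 4 ->
  cl5 (A i) (B j) (L k) (X i j k s) (X i j k (~~ s)).
Proof.
move=> fr hi hj hk; have [_ hX] := fr.
have [ab _ _] := frame_adj fr hi hj; have [_ al _] := frame_adj fr hi hk.
have [_ _ bl] := frame_adj fr hj hk.
have [xx h4 _] := hX _ _ _ hi hj hk; have /and3P [h5 h6 h7] := h4 s.
have /and3P [h5' h6' h7'] := h4 (~~ s); rewrite /clique5 ab al bl h5 h6 h7 h5' h6' h7' /=.
by case: s {h5 h6 h7 h5' h6' h7'}; rewrite // adjC.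
Qed.

Lemma clique5_rot u p q r s : cl5 u p q r s -> cl5 p q u r s.
Proof.
case/and5P => /and4P [up uq ur us] /and3P [pq pr ps] qr qs rs.
by rewrite /clique5 pq pr ps qr qs rs ur us ![adj _ u]adjC up uq.
Qed.

Lemma clique5_swap34 u p q r s : cl5 u p q r s -> cl5 u p r q s.
Proof.
case/and5P => /and4P [up uq ur us] /and3P [pq pr ps] qr qs rs.
by rewrite /clique5 up uq ur us pq pr ps qs rs adjC qr.
Qed.

(** If i' differs from i, an adjacency would give [A i'] three neighbours in the 5-clique of the
    cell, making it a member; but it is far from [A i]. *)
Lemma adj_AX A B L X i' i j k s : frame A B L X -> i' < 4 -> i < 4 -> j < 4 -> k < 4 ->
  adj (A i') (X i j k s) = (i' == i).
Proof.
move=> fr hi' hi hj hk; have c0 := cell_clique s fr hi hj hk.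
case/and5P: (c0) => /and4P [_ _ ax ax'] _ _ _ _.
have [->//|ii'] := eqVneq i' i; apply/negP => ai'.
have f : is_far adj (A i') (A i) by apply: (frame_farA fr).
have [ab _ _] := frame_adj fr hi' hj; have [_ al _] := frame_adj fr hi' hk.
have [] : A i' = A i \/ A i' = X i j k (~~ s).
- apply: (clique5_max adjxx tri (clique5_swap34 (clique5_rot c0))); by rewrite adjC.
- by move/eqP; apply/negP/far_neq.
by move=> E; move: (far_nadj f); rewrite adjC E ax'.
Qed.

Lemma adj_BX A B L X j' i j k s : frame A B L X -> j' < 4 -> i < 4 -> j < 4 -> k < 4 ->
  adj (B j') (X i j k s) = (j' == j).
Proof. by move=> fr hj' hi hj hk; apply: (adj_AX s (frame_swap12 fr)). Qed.

Lemma adj_LX A B L X k' i j k s : frame A B L X -> k' < 4 -> i < 4 -> j < 4 -> k < 4 ->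
  adj (L k') (X i j k s) = (k' == k).
Proof.
by move=> fr hk' hi hj hk; apply: (adj_AX s (frame_swap12 (frame_swap23 fr))).
Qed.

Lemma X_neq_K A B L X i i' j k s : frame A B L X -> i' < 4 -> i < 4 -> j < 4 -> k < 4 ->
  X i j k s != A i'.
Proof.
move=> fr hi' hi hj hk; apply/eqP => E.
have := adj_AX s fr hi hi hj hk; rewrite eqxx E.
have [<-|ii] := eqVneq i i'; first by rewrite adjxx.
by rewrite (negPf (far_nadj (frame_farA fr hi hi' ii))).
Qed.

(** A vertex of the second cell sees [A i] and [B j]; a third neighbour in the first cell's 5-clique
    would put it into that clique. *)
Lemma adj_XX2 A B L X i j k k' s s' : frame A B L X ->
  i < 4 -> j < 4 -> k < 4 -> k' < 4 -> k != k' ->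
  adj (X i j k s) (X i j k' s') = false.
Proof.
move=> fr hi hj hk hk' kk'; apply/negP => xx'.
have c0 := cell_clique s fr hi hj hk.
have [] : X i j k' s' = L k \/ X i j k' s' = X i j k (~~ s).
- have c1 : cl5 (A i) (B j) (X i j k s) (L k) (X i j k (~~ s)) by apply: clique5_swap34.
  apply: (clique5_max adjxx tri c1) => //.
    by rewrite (adj_AX _ fr).
  by rewrite (adj_BX _ fr).
- by apply/eqP; apply: (X_neq_K _ (frame_swap12 (frame_swap23 fr))).
move=> E; have := adj_LX s' fr hk hi hj hk'; rewrite E (adj_LX _ fr) // eqxx.
by rewrite (negPf kk').
Qed.

(** In the 5-clique of the second cell the vertex sees [A i] but neither [B j'] nor [L k'], so it
    sees exactly one of the two cell vertices. *)
Lemma adj_XX1 A B L X i j j' k k' s : frame A B L X ->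
  i < 4 -> j < 4 -> j' < 4 -> k < 4 -> k' < 4 -> j != j' -> k != k' ->
  adj (X i j k s) (X i j' k' true) = ~~ adj (X i j k s) (X i j' k' false).
Proof.
move=> fr hi hj hj' hk hk' jj' kk'; have c0 := cell_clique false fr hi hj' hk'.
have xB : adj (X i j k s) (B j') = false.
  by rewrite adjC (adj_BX _ fr) // eq_sym (negPf jj').
have xL : adj (X i j k s) (L k') = false.
  by rewrite adjC (adj_LX _ fr) // eq_sym (negPf kk').
have Ax : A i ~ X i j k s by rewrite (adj_AX _ fr).
have nB : X i j k s != B j' by apply: (X_neq_K _ (frame_swap12 fr)).
have nL : X i j k s != L k' by apply: (X_neq_K _ (frame_swap12 (frame_swap23 fr))).
have nX t : X i j k s != X i j' k' t.
  apply/eqP => E; have := adj_BX s fr hj hi hj hk.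
  by rewrite E (adj_BX _ fr) // eqxx (negPf jj').
have := gq c0 Ax; rewrite (negPf nB) (negPf nL) !(negPf (nX _)) xB xL /=.
case: (boolP (adj _ (X i j' k' false))) => // f1 _; apply/negbTE/negP => f2.
have c1 : cl5 (A i) (X i j' k' false) (X i j' k' true) (B j') (L k').
  case/and5P: c0 => /and4P [h1 h2 h3 h4] /and3P [h5 h6 h7] h8 h9 h10.
  by rewrite /clique5 h1 h2 h3 h4 h5 h10 ![adj (X _ _ _ _) _]adjC h6 h7 h8 h9.
have [] : X i j k s = B j' \/ X i j k s = L k'.
- by apply: (clique5_max adjxx tri c1); rewrite // adjC.
- by move/eqP; rewrite (negPf nB).
by move/eqP; rewrite (negPf nL).
Qed.

Lemma adj_XXs A B L X i j j' k k' s s' : frame A B L X ->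
  i < 4 -> j < 4 -> j' < 4 -> k < 4 -> k' < 4 -> j != j' -> k != k' ->
  adj (X i j k s) (X i j' k' s') = adj (X i j k false) (X i j' k' false) (+) s (+) s'.
Proof.
move=> fr hi hj hj' hk hk' jj' kk'.
have h1 t : adj (X i j k t) (X i j' k' s') = adj (X i j k t) (X i j' k' false) (+) s'.
  by case: s'; rewrite ?addbF // (adj_XX1 _ fr) // addbT.
rewrite h1; case: s; last by rewrite addbF.
rewrite [adj (X i j k true) _]adjC (adj_XX1 _ fr) 1?eq_sym // addbT.
by rewrite [adj (X i j' k' false) _]adjC.
Qed.

Lemma adj_XXsB A B L X i i' j k k' s s' : frame A B L X ->
  i < 4 -> i' < 4 -> j < 4 -> k < 4 -> k' < 4 -> i != i' -> k != k' ->
  adj (X i j k s) (X i' j k' s') = adj (X i j k false) (X i' j k' false) (+) s (+) s'.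
Proof. by move=> fr *; apply: (adj_XXs s s' (frame_swap12 fr)). Qed.

Lemma adj_XXsL A B L X i i' j j' k s s' : frame A B L X ->
  i < 4 -> i' < 4 -> j < 4 -> j' < 4 -> k < 4 -> i != i' -> j != j' ->
  adj (X i j k s) (X i' j' k s') = adj (X i j k false) (X i' j' k false) (+) s (+) s'.
Proof. by move=> fr *; apply: (adj_XXs s s' (frame_swap12 (frame_swap23 fr))). Qed.

(** Otherwise [A i] and the second vertex would be far apart, with common neighbours [B j'], [L k']
    and the first vertex. By the K_{4,4} property the latter would see one end of the edge from
    [B j'] to [L k']. *)
Lemma adj_XX0 A B L X i i' j j' k k' s s' : frame A B L X ->
  i < 4 -> j < 4 -> k < 4 -> i' < 4 -> j' < 4 -> k' < 4 -> i != i' -> j != j' -> k != k' ->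
  adj (X i j k s) (X i' j' k' s') = false.
Proof.
move=> fr hi hj hk hi' hj' hk' ii' jj' kk'; apply/negP => xx'.
have f : is_far adj (A i) (X i' j' k' s').
  by rewrite /is_far (X_neq_K _ fr) // (adj_AX _ fr) // (negPf ii').
have [_ _ bl] := frame_adj fr hj' hk'; have [ab _ _] := frame_adj fr hi hj'.
have [_ al _] := frame_adj fr hi hk'.
have Ax : A i ~ X i j k s by rewrite (adj_AX _ fr).
have xB : X i' j' k' s' ~ B j' by rewrite adjC (adj_BX _ fr).
have xL : X i' j' k' s' ~ L k' by rewrite adjC (adj_LX _ fr).
rewrite adjC in xx'; have := K44 f ab al Ax xB xL xx' bl.
rewrite ![adj (X i j k s) _]adjC (adj_BX _ fr) // (adj_LX _ fr) //.
by rewrite eq_sym (negPf jj') eq_sym (negPf kk').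
Qed.

(* The third vertex of the 5-clique on [x1], [B j], [x3] that [x2] could see
   instead of [x3] would, with [L k'], have [x2], [x3], [B j] in its mu-graph. *)
Lemma star A B L X i i' j j' k k' s1 s2 s3 : frame A B L X ->
  i < 4 -> j < 4 -> k < 4 -> i' < 4 -> j' < 4 -> k' < 4 -> i != i' -> j != j' -> k != k' ->
  X i j k s1 ~ X i j' k' s2 -> X i j k s1 ~ X i' j k' s3 ->
  X i j' k' s2 ~ X i' j k' s3.
Proof.
move=> fr hi hj hk hi' hj' hk' ii' jj' kk'.
set x1 := X i j k s1; set x2 := X i j' k' s2; set x3 := X i' j k' s3 => x12 x13.
have x1B : x1 ~ B j by rewrite adjC (adj_BX _ fr).
have Bx3 : B j ~ x3 by rewrite (adj_BX _ fr).
have nx2B : adj x2 (B j) = false by rewrite adjC (adj_BX _ fr) // (negPf jj').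
have Lx1 : adj (L k') x1 = false by rewrite (adj_LX _ fr) // eq_sym (negPf kk').
have Lx2 : L k' ~ x2 by rewrite (adj_LX _ fr).
have Lx3 : L k' ~ x3 by rewrite (adj_LX _ fr).
have [_ _ BL] := frame_adj fr hj hk'.
have [s [t [st [x1s Bs x3s] [x1t Bt x3t] _]]] := tri x1B x13 Bx3.
have key z : x1 ~ z -> B j ~ z -> x3 ~ z -> x2 ~ z -> x2 ~ x3.
  move=> x1z Bz x3z x2z.
  have f : is_far adj (L k') z.
    have zL : z != L k' by apply: contraTneq x1z => ->; rewrite adjC Lx1.
    rewrite /is_far zL; apply/negP => Lz.
    have c0 := clique5_swap34 (clique5_rot (cell_clique s3 fr hi' hj hk')).
    have [] : z = A i' \/ z = X i' j k' (~~ s3) by apply: (clique5_max adjxx tri c0).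
      by move=> zA; move: x1z; rewrite zA adjC (adj_AX _ fr) // eq_sym (negPf ii').
    move=> zx; move: x1z x13; rewrite zx /x1 /x3.
    rewrite (adj_XXsB s1 (~~ s3) fr) // (adj_XXsB s1 s3 fr) // addbN => /negP h1 h2; exact: h1.
  have : adj x2 x3 || adj x2 (B j).
    by apply: (K44 f) => //; rewrite adjC.
  by rewrite nx2B orbF.
have c : cl5 x1 (B j) x3 s t by rewrite /clique5 x1B x13 x1s x1t Bx3 Bs Bt x3s x3t st.
have := gq c x12; rewrite nx2B.
have -> : (x2 == B j) = false.
  by apply/negbTE; apply: (X_neq_K _ (frame_swap12 fr)).
have -> : (x2 == x3) = false.
  by apply/negbTE/eqP => E; move: Bx3; rewrite -E adjC nx2B.
have -> : (x2 == s) = false.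
  by apply/negbTE/eqP => E; move: Bs; rewrite -E adjC nx2B.
have -> : (x2 == t) = false.
  by apply/negbTE/eqP => E; move: Bt; rewrite -E adjC nx2B.
by rewrite /= => /or3P [//|x2s|x2t]; [exact: (key s)|exact: (key t)].
Qed.

Lemma star_sum A B L X i i' j j' k k' : frame A B L X ->
  i < 4 -> j < 4 -> k < 4 -> i' < 4 -> j' < 4 -> k' < 4 -> i != i' -> j != j' -> k != k' ->
  adj (X i j k false) (X i j' k' false) (+) adj (X i j k false) (X i' j k' false)
    (+) adj (X i j' k' false) (X i' j k' false) = true.
Proof.
move=> fr hi hj hk hi' hj' hk' ii' jj' kk'.
have e1 s2 := adj_XXs false s2 fr hi hj hj' hk hk' jj' kk'.
have e2 s3 := adj_XXsB false s3 fr hi hi' hj hk hk' ii' kk'.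
have j'j : j' != j by rewrite eq_sym.
have e3 s2 s3 := adj_XXsL s2 s3 fr hi hi' hj' hj hk' ii' j'j.
have st s2 s3 := @star A B L X i i' j j' k k' false s2 s3 fr hi hj hk hi' hj' hk' ii' jj' kk'.
move: st; set m12 := adj _ _ in e1 *; set m13 := adj _ _ in e2 *; set m23 := adj _ _ in e3 *.
move=> /(_ (~~ m12) (~~ m13)); rewrite e1 e2 e3; clear e1 e2 e3.
by case: m12; case: m13; case: m23 => //= /(_ isT isT).
Qed.

(** The first three vertices and [A i] lie in one 5-clique. [B j3] and [L k3] see [A i] but none of
    the three, so both see its fifth vertex, which is therefore in the cell (i, j3, k3). The first
    vertex sees only one vertex of that cell. *)
Lemma line_step A B L X i j j1 j2 j3 k k1 k2 k3 s s1 s2 s3 : frame A B L X ->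
  i < 4 -> all (gtn 4) [:: j; j1; j2; j3] -> all (gtn 4) [:: k; k1; k2; k3] ->
  uniq [:: j; j1; j2; j3] -> uniq [:: k; k1; k2; k3] ->
  X i j k s ~ X i j1 k1 s1 -> X i j k s ~ X i j2 k2 s2 -> X i j k s ~ X i j3 k3 s3 ->
  X i j1 k1 s1 ~ X i j2 k2 s2 -> X i j1 k1 s1 ~ X i j3 k3 s3.
Proof.
move=> fr hi /and5P [hj hj1 hj2 hj3 _] /and5P [hk hk1 hk2 hk3 _].
rewrite /= !inE !negb_or => /and4P [/and3P [n1 n2 n3] /andP [n4 n5] n6 _].
case/and4P => /and3P [m1 m2 m3] /andP [m4 m5] m6 _ x01 x02 x03 x12.
have [_ hX] := fr; have [_ _ cellP] := hX _ _ _ hi hj3 hk3.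
have Ax : A i ~ X i j k s by rewrite (adj_AX _ fr).
have Ax1 : A i ~ X i j1 k1 s1 by rewrite (adj_AX _ fr).
have Ax2 : A i ~ X i j2 k2 s2 by rewrite (adj_AX _ fr).
have key z : A i ~ z -> X i j k s ~ z -> X i j1 k1 s1 ~ z -> X i j2 k2 s2 ~ z ->
    X i j1 k1 s1 ~ X i j3 k3 s3.
  move=> Az xz x1z x2z.
  have c : cl5 (A i) (X i j k s) (X i j1 k1 s1) (X i j2 k2 s2) z.
    by rewrite /clique5 Ax Ax1 Ax2 Az x01 x02 xz x12 x1z x2z.
  have [AB _ _] := frame_adj fr hi hj3; have [_ AL _] := frame_adj fr hi hk3.
  have Bz : B j3 ~ z.
    have := gq c AB; rewrite ![B j3 == X _ _ _ _]eq_sym.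
    rewrite !(negPf (X_neq_K _ (frame_swap12 fr) _ _ _ _)) // !(adj_BX _ fr) //.
    rewrite ![j3 == _]eq_sym (negPf n3) (negPf n5) (negPf n6) /= => /orP [/eqP E|//].
    by move: xz; rewrite -E adjC (adj_BX _ fr) // eq_sym (negPf n3).
  have Lz : L k3 ~ z.
    have := gq c AL; rewrite ![L k3 == X _ _ _ _]eq_sym.
    rewrite !(negPf (X_neq_K _ (frame_swap12 (frame_swap23 fr)) _ _ _ _)) // !(adj_LX _ fr) //.
    rewrite ![k3 == _]eq_sym (negPf m3) (negPf m5) (negPf m6) /= => /orP [/eqP E|//].
    by move: xz; rewrite -E adjC (adj_LX _ fr) // eq_sym (negPf m3).
  have [b zE] := cellP _ Az Bz Lz.
  suff -> : s3 = b by rewrite -zE.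
  move: x03 xz; rewrite zE (adj_XXs s s3 fr) // (adj_XXs s b fr) //.
  by case: (adj _ _); case: (s); case: (s3); case: (b).
have [z [t [zt [Az xz x1z] [At xt x1t] h]]] := tri Ax Ax1 x01.
case: (h _ Ax2 x02 x12) => E.
  by apply: (key t) => //; rewrite E.
by apply: (key z) => //; rewrite E adjC.
Qed.

Lemma line_sum A B L X i j j1 j2 j3 k k1 k2 k3 : frame A B L X ->
  i < 4 -> all (gtn 4) [:: j; j1; j2; j3] -> all (gtn 4) [:: k; k1; k2; k3] ->
  uniq [:: j; j1; j2; j3] -> uniq [:: k; k1; k2; k3] ->
  adj (X i j k false) (X i j2 k2 false) (+) adj (X i j1 k1 false) (X i j2 k2 false)
  (+) adj (X i j k false) (X i j3 k3 false) (+) adj (X i j1 k1 false) (X i j3 k3 false) = false.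
Proof.
move=> fr hi hjs hks ujs uks.
have s1 := @line_step A B L X i j j1 j2 j3 k k1 k2 k3 false
  (~~ adj (X i j k false) (X i j1 k1 false)) (~~ adj (X i j k false) (X i j2 k2 false))
  (~~ adj (X i j k false) (X i j3 k3 false)) fr hi hjs hks ujs uks.
have p l0 l1 l2 l3 : all (gtn 4) [:: l0; l1; l2; l3] -> uniq [:: l0; l1; l2; l3] ->
    all (gtn 4) [:: l0; l1; l3; l2] && uniq [:: l0; l1; l3; l2].
  rewrite /= !inE !negb_or => /and5P [-> -> -> -> _] /and4P [/and3P [-> -> ->] /andP [-> ->]].
  by rewrite eq_sym => ->.
have /andP [hjs' ujs'] := p _ _ _ _ hjs ujs; have /andP [hks' uks'] := p _ _ _ _ hks uks.
(* With 2 and 3 exchanged this is the converse implication; together they give an equality of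
   signs. *)
have s2 := @line_step A B L X i j j1 j3 j2 k k1 k3 k2 false
  (~~ adj (X i j k false) (X i j1 k1 false)) (~~ adj (X i j k false) (X i j3 k3 false))
  (~~ adj (X i j k false) (X i j2 k2 false)) fr hi hjs' hks' ujs' uks'.
move: s1 s2 hjs hks ujs uks; rewrite /= !inE !negb_or.
move=> s1 s2 /and5P [hj hj1 hj2 hj3 _] /and5P [hk hk1 hk2 hk3 _].
move=> /and4P [/and3P [n1 n2 n3] /andP [n4 n5] n6 _].
case/and4P => /and3P [m1 m2 m3] /andP [m4 m5] m6 _.
have e1 t t' := adj_XXs t t' fr hi hj hj1 hk hk1 n1 m1.
have e2 t t' := adj_XXs t t' fr hi hj hj2 hk hk2 n2 m2.
have e3 t t' := adj_XXs t t' fr hi hj hj3 hk hk3 n3 m3.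
have e4 t t' := adj_XXs t t' fr hi hj1 hj2 hk1 hk2 n4 m4.
have e5 t t' := adj_XXs t t' fr hi hj1 hj3 hk1 hk3 n5 m5.
move: s1 s2; set b1 := adj _ (X i j1 k1 false) in e1 *.
set b2 := adj (X i j k false) (X i j2 k2 false) in e2 *.
set b3 := adj (X i j k false) (X i j3 k3 false) in e3 *.
set b4 := adj (X i j1 k1 false) (X i j2 k2 false) in e4 *.
set b5 := adj (X i j1 k1 false) (X i j3 k3 false) in e5 *.
rewrite e1 e2 e3 e4 e5; clear e1 e2 e3 e4 e5.
by case: b1; case: b2; case: b3; case: b4; case: b5 => //= h1 h2;
  first [by have := h1 isT isT isT isT | by have := h2 isT isT isT isT].
Qed.

Lemma parity_sum A B L X i j j1 j2 k k1 k2 : frame A B L X ->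
  i < 4 -> all (gtn 4) [:: j; j1; j2] -> all (gtn 4) [:: k; k1; k2] ->
  uniq [:: j; j1; j2] -> uniq [:: k; k1; k2] ->
  adj (X i j k false) (X i j1 k1 false) (+) adj (X i j k false) (X i j2 k2 false)
  (+) adj (X i j1 k1 false) (X i j2 k2 false)
  (+) adj (X i j k1 false) (X i j1 k false) (+) adj (X i j k1 false) (X i j2 k2 false)
  (+) adj (X i j1 k false) (X i j2 k2 false) = true.
Proof.
move=> fr hi /and4P [hj hj1 hj2 _] /and4P [hk hk1 hk2 _].
rewrite /= !inE !negb_or => /and3P [/andP [n1 n2] n3 _] /and3P [/andP [m1 m2] m3 _].
(* In each cell this sign selects the vertex adjacent to [X i j2 k2 false], which plays the part of
   c in [parity_axiom]. *)
pose sg a b := ~~ adj (X i a b false) (X i j2 k2 false).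
have := @parity (A i) (B j) (B j1) (L k) (L k1) (X i j2 k2 false)
  (X i j k (sg j k)) (X i j1 k1 (sg j1 k1)) (X i j k1 (sg j k1)) (X i j1 k (sg j1 k)).
have [-> _ _] := frame_adj fr hi hj; have [-> _ _] := frame_adj fr hi hj1.
have [_ -> _] := frame_adj fr hi hk; have [_ -> _] := frame_adj fr hi hk1.
have [_ _ ->] := frame_adj fr hj hk; have [_ _ ->] := frame_adj fr hj hk1.
have [_ _ ->] := frame_adj fr hj1 hk; have [_ _ ->] := frame_adj fr hj1 hk1.
rewrite !(adj_AX _ fr) // eqxx (frame_farA (frame_swap12 fr)) //.
rewrite (frame_farA (frame_swap12 (frame_swap23 fr))) //.
rewrite ![adj _ (B _)]adjC ![adj _ (L _)]adjC !(adj_BX _ fr) // !(adj_LX _ fr) // !eqxx.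
rewrite (negPf n2) (negPf n3) (negPf m2) (negPf m3).
have kk : k1 != k by rewrite eq_sym.
have e1 t t' := adj_XXs t t' fr hi hj hj1 hk hk1 n1 m1.
have e2 t t' := adj_XXs t t' fr hi hj hj2 hk hk2 n2 m2.
have e3 t t' := adj_XXs t t' fr hi hj1 hj2 hk1 hk2 n3 m3.
have e4 t t' := adj_XXs t t' fr hi hj hj1 hk1 hk n1 kk.
have e5 t t' := adj_XXs t t' fr hi hj hj2 hk1 hk2 n2 m3.
have e6 t t' := adj_XXs t t' fr hi hj1 hj2 hk hk2 n3 m2.
rewrite ![adj (X i j2 k2 false) _]adjC /sg e1 e4.
rewrite [adj (X i j k (~~ _)) _]e2 [adj (X i j1 k1 (~~ _)) _]e3.
rewrite [adj (X i j k1 (~~ _)) _]e5 [adj (X i j1 k (~~ _)) _]e6.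
set b1 := adj (X i j k false) (X i j1 k1 false).
set b2 := adj (X i j k false) (X i j2 k2 false).
set b3 := adj (X i j1 k1 false) (X i j2 k2 false).
set b4 := adj (X i j k1 false) (X i j1 k false).
set b5 := adj (X i j k1 false) (X i j2 k2 false).
set b6 := adj (X i j1 k false) (X i j2 k2 false).
by case: b1; case: b2; case: b3; case: b4; case: b5; case: b6 => //=;
  move=> /(_ isT isT isT isT isT isT isT isT).
Qed.

Lemma frame_exists A B L : K444 adj A B L -> exists X, frame A B L X.
Proof.
move=> hK; have [h1 _] := hK.
have ex (t : nat * nat * nat) : exists g : bool -> V,
    t.1.1 < 4 -> t.1.2 < 4 -> t.2 < 4 ->
    [/\ adj (g false) (g true),
      forall s, [&& adj (A t.1.1) (g s), adj (B t.1.2) (g s) & adj (L t.2) (g s)] &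
      forall y, adj (A t.1.1) y -> adj (B t.1.2) y -> adj (L t.2) y -> exists s, y = g s].
  case: t => [[i j] k]; cbn [fst snd].
  have [/andP [/andP [hi hj] hk]|n] := boolP ((i < 4) && (j < 4) && (k < 4)); last first.
    by exists (fun=> A 0) => hi hj hk; case/negP: n; rewrite hi hj hk.
  have /and3P [ab _ _] := h1 _ _ hi hj; have /and3P [_ al _] := h1 _ _ hi hk.
  have /and3P [_ _ bl] := h1 _ _ hj hk.
  have [s [t [st [a1 a2 a3] [b1 b2 b3] h]]] := tri ab al bl.
  exists (fun b : bool => if b then t else s) => _ _ _; split=> // [[]|y y1 y2 y3].
  - by rewrite b1 b2 b3.
  - by rewrite a1 a2 a3.
  by case: (h _ y1 y2 y3) => ->; [exists false|exists true].
pose X i j k := sval (constructive_indefinite_description _ (ex (i, j, k))).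
exists X; split=> // i j k; rewrite /X.
by case: constructive_indefinite_description => g hg; apply: hg.
Qed.

Definition swap12 k := match k with 1 => 2 | 2 => 1 | _ => k end.

Lemma swap12_lt k : k < 4 -> swap12 k < 4.
Proof. by case: k => [|[|[|[]]]]. Qed.

Lemma swap12_eq k k' : (swap12 k == swap12 k') = (k == k').
Proof. by case: k => [|[|[|k]]]; case: k' => [|[|[|k']]]. Qed.

Lemma frame_permL A B L X : frame A B L X ->
  frame A B (fun k => L (swap12 k)) (fun i j k => X i j (swap12 k)).
Proof.
move=> [[h1 h2] h3]; split; first split => i j hi hj => [|ij].
- have /and3P [-> _ _] := h1 _ _ hi hj.
  by have /and3P [_ -> ->] := h1 _ _ hi (swap12_lt hj).
- have /and3P [-> -> _] := h2 _ _ hi hj ij.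
  have ij' : swap12 i != swap12 j by rewrite swap12_eq.
  by have /and3P [_ _ ->] := h2 _ _ (swap12_lt hi) (swap12_lt hj) ij'.
by move=> i j k hi hj hk; apply: h3 => //; apply: swap12_lt.
Qed.

Lemma frame_permA A B L X : frame A B L X ->
  frame (fun i => A (swap12 i)) B L (fun i j k => X (swap12 i) j k).
Proof.
move=> fr; have := frame_permL (frame_swap23 (frame_swap12 fr)).
by move/frame_swap23/frame_swap12.
Qed.

Lemma frame_relabel A B L X (lam : nat -> bool) : frame A B L X ->
  frame A B L (fun i j k s => X i j k (s (+) lam (cell i j k))).
Proof.
move=> [hK hX]; split=> // i j k hi hj hk; have [h1 h2 h3] := hX _ _ _ hi hj hk.
split=> [|s|y a b c].
- by case: (lam _); rewrite // adjC.
- exact: h2.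
have [s ->] := h3 _ a b c; exists (s (+) lam (cell i j k)).
by rewrite -addbA addbb addbF.
Qed.

Definition tri_sum (X : nat -> nat -> nat -> bool -> V) c1 c2 c3 :=
  let x c := X (coord 0 c) (coord 1 c) (coord 2 c) false in
  adj (x c1) (x c2) (+) adj (x c1) (x c3) (+) adj (x c2) (x c3).

Definition normal X := tri_sum X (cell 0 0 0) (cell 0 1 1) (cell 0 2 2) /\
  tri_sum X (cell 0 0 0) (cell 1 0 1) (cell 2 0 2).

(** By [parity_sum] the triangle with cells (0,0), (1,1), (2,2) in a plane and the one with (0,0),
    (1,2), (2,1) have different sums, so transposing 1 and 2 repairs a wrong value. *)
Lemma normal_frame A B L : K444 adj A B L ->
  exists A' B' L' X, frame A' B' L' X /\ normal X.
Proof.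
move=> /frame_exists [X fr].
have [L' [X' [fr' n1]]] : exists L' X', frame A B L' X' /\
    tri_sum X' (cell 0 0 0) (cell 0 1 1) (cell 0 2 2).
  have [h|nb] := boolP (tri_sum X (cell 0 0 0) (cell 0 1 1) (cell 0 2 2)).
    by exists L, X.
  exists (fun k => L (swap12 k)), (fun i j k => X i j (swap12 k)).
  split; first exact: frame_permL.
  have := parity_sum (i := 0) (j := 1) (j1 := 2) (j2 := 0) (k := 1) (k1 := 2) (k2 := 0) fr
    isT isT isT isT isT.
  move: nb; rewrite /tri_sum /= ![adj (X 0 0 0 false) _]adjC.
  by do 6 case: (adj _ _).
have [h|nb] := boolP (tri_sum X' (cell 0 0 0) (cell 1 0 1) (cell 2 0 2)).
  by exists A, B, L', X'.
(* The transposition fixes the index 0 of [A], so the first normalisation, inside the plane i = 0,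
   survives. *)
exists (fun i => A (swap12 i)), B, L', (fun i j k => X' (swap12 i) j k).
split; first exact: frame_permA.
split; first exact: n1.
have := parity_sum (i := 0) (j := 1) (j1 := 2) (j2 := 0) (k := 1) (k1 := 2) (k2 := 0)
  (frame_swap12 fr') isT isT isT isT isT.
move: nb; rewrite /tri_sum /= ![adj (X' 0 0 0 false) _]adjC.
rewrite [adj (X' 2 0 1 false) (X' 1 _ _ _)]adjC.
by do 6 case: (adj _ _).
Qed.

Definition Mof (X : nat -> nat -> nat -> bool -> V) c d :=
  adj (X (coord 0 c) (coord 1 c) (coord 2 c) false) (X (coord 0 d) (coord 1 d) (coord 2 d) false).

Lemma coord_cell i j k : i < 4 -> j < 4 -> k < 4 ->
  [/\ coord 0 (cell i j k) = i, coord 1 (cell i j k) = j & coord 2 (cell i j k) = k].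
Proof.
by case: i => [|[|[|[]]]] //; case: j => [|[|[|[]]]] //; case: k => [|[|[|[]]]].
Qed.

Lemma Mof_cell X i j k i' j' k' : i < 4 -> j < 4 -> k < 4 -> i' < 4 -> j' < 4 -> k' < 4 ->
  Mof X (cell i j k) (cell i' j' k') = adj (X i j k false) (X i' j' k' false).
Proof.
move=> hi hj hk hi' hj' hk'; rewrite /Mof.
have [-> -> ->] := coord_cell hi hj hk.
by have [-> -> ->] := coord_cell hi' hj' hk'.
Qed.

Lemma Mof_ed X c d : Mof X (ed c d).1 (ed c d).2 = Mof X c d.
Proof. by rewrite /ed; case: ifP => // _; rewrite /Mof adjC. Qed.

Lemma esum_cons M e l : esum M (e :: l) = M e.1 e.2 (+) esum M l. Proof. by []. Qed.
Lemma esum_nil M : esum M [::] = false. Proof. by []. Qed.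

Lemma frame_eqs A B L X : frame A B L X -> normal X ->
  forall e, e \in eqs -> esum (Mof X) e.1 = e.2.
Proof.
move=> fr [n1 n2] e; rewrite /eqs !mem_cat => /or4P [].
- rewrite !inE => /orP [] /eqP -> /=; rewrite !esum_cons esum_nil !Mof_ed addbF.
    by move: n1; rewrite /tri_sum /= /Mof => <-; rewrite addbA.
  by move: n2; rewrite /tri_sum /= /Mof => <-; rewrite addbA.
- case/mapP => t; rewrite mem_filter => /andP [g _] ->; move: g.
  case: t => [|i [|i' [|j [|j' [|k [|k' []]]]]]] //.
  case/and4P => /and5P [hi hi' hj hj' /and3P [hk hk' _]] ii' jj' kk'.
  rewrite /star_eq !esum_cons esum_nil !Mof_ed !Mof_cell // addbF addbA.
  exact: (star_sum fr).
- case/mapP => t; rewrite mem_filter => /andP [g _] ->; move: g.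
  case: t => [|x [|a [|j [|j1 [|j2 [|j3 [|k [|k1 [|k2 [|k3 []]]]]]]]]]] //.
  case/and4P => hx ha hj /and3P [hk uj uk].
  have /and5P [g1 g2 g3 g4 _] := hj; have /and5P [g5 g6 g7 g8 _] := hk.
  rewrite /line_eq !esum_cons esum_nil !Mof_ed addbF !addbA.
  case: x hx => [|[|[|[]]]] // _; rewrite /axcell !Mof_cell //.
  + exact: (line_sum fr).
  + exact: (line_sum (frame_swap12 fr)).
  + exact: (line_sum (frame_swap12 (frame_swap23 fr))).
case/mapP => t; rewrite mem_filter => /andP [g _] ->; move: g.
case: t => [|x [|a [|j [|j1 [|j2 [|k [|k1 [|k2 []]]]]]]]] //.
case/and4P => hx ha hj /and3P [hk uj uk].
have /and4P [g1 g2 g3 _] := hj; have /and4P [g5 g6 g7 _] := hk.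
rewrite /parity_eq !esum_cons esum_nil !Mof_ed addbF !addbA.
case: x hx => [|[|[|[]]]] // _; rewrite /axcell !Mof_cell //.
+ exact: (parity_sum fr).
+ exact: (parity_sum (frame_swap12 fr)).
+ exact: (parity_sum (frame_swap12 (frame_swap23 fr))).
Qed.

Definition Xc (X : nat -> nat -> nat -> bool -> V) c s :=
  X (coord 0 c) (coord 1 c) (coord 2 c) s.

Lemma adj_Xc A B L X c d s s' : frame A B L X -> c < 64 -> d < 64 ->
  adj (Xc X c s) (Xc X d s') = if c == d then s != s'
    else if ncommon c d == 1 then Mof X c d (+) s (+) s' else false.
Proof.
move=> fr hc hd.
have -> : (c == d) = [&& coord 0 c == coord 0 d, coord 1 c == coord 1 d & coord 2 c == coord 2 d].
  apply/eqP/and3P => [->//|[/eqP h0 /eqP h1 /eqP h2]].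
  by rewrite -(cell_coord c) h0 h1 h2 cell_coord.
have [hi hj hk] := And3 (coord_lt 0 hc) (coord_lt 1 hc) (coord_lt 2 hc).
have [hi' hj' hk'] := And3 (coord_lt 0 hd) (coord_lt 1 hd) (coord_lt 2 hd).
rewrite /Xc /Mof /ncommon.
move: (coord 0 c) (coord 1 c) (coord 2 c) (coord 0 d) (coord 1 d) (coord 2 d) hi hj hk hi' hj' hk'.
move=> i j k i' j' k' hi hj hk hi' hj' hk'.
have [<-{i' hi'}|ii] := eqVneq i i'; have [<-{j' hj'}|jj] := eqVneq j j';
  have [<-{k' hk'}|kk] := eqVneq k k' => /=.
- have [_ h] := fr; have [h1 _ _] := h _ _ _ hi hj hk.
  by case: s; case: s'; rewrite ?adjxx // adjC.
- exact: (adj_XX2 _ _ fr).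
- exact: (adj_XX2 _ _ (frame_swap23 fr)).
- exact: (adj_XXs _ _ fr).
- exact: (adj_XX2 _ _ (frame_swap23 (frame_swap12 fr))).
- exact: (adj_XXsB _ _ fr).
- exact: (adj_XXsL _ _ fr).
exact: (adj_XX0 _ _ fr).
Qed.

Lemma ncommon_neq c d : ncommon c d = 1 -> c != d.
Proof. by apply: contra_eqN => /eqP ->; rewrite /ncommon !eqxx. Qed.

(** After relabelling by [lam], the signs and those of U_5 agree on the spanning tree and satisfy
    the same equations; their difference is then zero by propagation. *)
Lemma standard_frame A0 B0 L0 : K444 adj A0 B0 L0 ->
  exists A B L X, frame A B L X /\
    forall c d, c < 64 -> d < 64 -> ncommon c d = 1 -> Mof X c d = Ms c d.
Proof.
move=> /normal_frame [A [B [L [X [fr [n1 n2]]]]]].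
pose a c d := Mof X c d (+) Ms (ed c d).1 (ed c d).2.
have [lam hlam] := tree_gauge a fresh_treeP.
pose X' i j k s := X i j k (s (+) lam (cell i j k)).
have fr' : frame A B L X' := frame_relabel lam fr.
have ME c d : c < 64 -> d < 64 -> ncommon c d = 1 ->
    Mof X' c d = Mof X c d (+) lam c (+) lam d.
  move=> hc hd cd; have := adj_Xc (lam c) (lam d) fr hc hd.
  by rewrite (negPf (ncommon_neq cd)) cd eqxx => <-; rewrite /Mof /X' /Xc !cell_coord !addFb.
(* Each value of [lam] occurs twice around a triangle, so relabelling does not disturb the
   normalisation. *)
have triE c1 c2 c3 : c1 < 64 -> c2 < 64 -> c3 < 64 -> ncommon c1 c2 = 1 ->
    ncommon c1 c3 = 1 -> ncommon c2 c3 = 1 -> tri_sum X' c1 c2 c3 = tri_sum X c1 c2 c3.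
  move=> h1 h2 h3 c12 c13 c23.
  rewrite -[tri_sum X' _ _ _]/(Mof X' c1 c2 (+) Mof X' c1 c3 (+) Mof X' c2 c3).
  rewrite -[tri_sum X _ _ _]/(Mof X c1 c2 (+) Mof X c1 c3 (+) Mof X c2 c3).
  rewrite !ME //; by do 3 case: (Mof _ _ _); do 3 case: (lam _).
have nX' : normal X' by split; rewrite triE.
pose n c d := Mof X' c d (+) Ms c d.
have nE l : esum n l = esum (Mof X') l (+) esum Ms l.
  by elim: l => //= e l IH; rewrite !esum_cons IH /n addbACA.
have n0 : forall c d, c < 64 -> d < 64 -> c < d -> ncommon c d = 1 -> n c d = false.
  apply: n_zero => e he.
    have /allP /(_ _ he) := treeP => /and3P [h1 h2 /eqP h3].
    rewrite /n Mof_ed ME //; have := hlam _ he; rewrite /a.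
    by case: (lam _); case: (lam _); case: (Mof X _ _); case: (Ms _ _).
  rewrite nE (frame_eqs fr' nX' he).
  by have /allP /(_ _ he) /eqP -> := eqs_target; rewrite addbb.
exists A, B, L, X'; split=> // c d hc hd cd.
have eqn b b' : b (+) b' = false -> b = b' by case: b; case: b'.
case: (ltngtP c d) => [lt|lt|E].
- exact/eqn/n0.
- rewrite Ms_sym // /Mof adjC; apply/eqn/n0 => //; move: cd; rewrite /ncommon.
  by rewrite ![coord _ d == _]eq_sym.
by have := ncommon_neq cd; rewrite E eqxx.
Qed.

(** * The embedding of U_5 *)

Section Embedding.
Variables (A B L : nat -> V) (X : nat -> nat -> nat -> bool -> V).
Hypothesis fr : frame A B L X.
Hypothesis std : forall c d, c < 64 -> d < 64 -> ncommon c d = 1 -> Mof X c d = Ms c d.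

Definition f0 n := if n < 4 then A n else if n < 8 then B (n - 4)
  else if n < 12 then L (n - 8) else Xc X (n - 12)./2 (odd n).

Lemma adj_KX t n c s : n < 4 -> c < 64 -> t < 3 ->
  adj (f0 (t * 4 + n)) (Xc X c s) = (coord t c == n).
Proof.
move=> hn hc; have [h0 h1 h2] := And3 (coord_lt 0 hc) (coord_lt 1 hc) (coord_lt 2 hc).
have [fA fB fL] : [/\ f0 (0 * 4 + n) = A n, f0 (1 * 4 + n) = B n & f0 (2 * 4 + n) = L n].
  by case: n hn => [|[|[|[]]]].
rewrite eq_sym; case: t => [|[|[|t]]] // _; rewrite ?fA ?fB ?fL /Xc.
- by rewrite (adj_AX _ fr).
- by rewrite (adj_BX _ fr).
by rewrite (adj_LX _ fr).
Qed.

Lemma adj_KK n m : n < 12 -> m < 12 -> adj (f0 n) (f0 m) = (n %/ 4 != m %/ 4).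
Proof.
have [[h1 h2] _] := fr.
have AB i j : i < 4 -> j < 4 -> adj (A i) (B j).
  by move=> *; have [] := frame_adj fr (i := i) (j := j).
have AL i j : i < 4 -> j < 4 -> adj (A i) (L j).
  by move=> *; have [] := frame_adj fr (i := i) (j := j).
have BL i j : i < 4 -> j < 4 -> adj (B i) (L j).
  by move=> *; have [] := frame_adj fr (i := i) (j := j).
have same (K : nat -> V) : (forall i j, i < 4 -> j < 4 -> i != j -> is_far adj (K i) (K j)) ->
    forall i j, i < 4 -> j < 4 -> adj (K i) (K j) = false.
  move=> h i j hi hj; have [->|ij] := eqVneq i j; first exact: adjxx.
  exact/negbTE/far_nadj/h.
have AA := same A (fun i j hi hj ij => frame_farA fr hi hj ij).
have BB := same B (fun i j hi hj ij => frame_farA (frame_swap12 fr) hi hj ij).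
have LL := same L (fun i j hi hj ij => frame_farA (frame_swap12 (frame_swap23 fr)) hi hj ij).
do 12 (case: n => [|n]; first by do 12 (case: m => [|m];
  first by rewrite /f0 /= ?AA ?BB ?LL ?AB ?AL ?BL // adjC ?AB ?AL ?BL)).
by [].
Qed.

Lemma half_lt n : n < 140 -> (n - 12)./2 < 64.
Proof. by move=> hn; rewrite ltn_half_double ltn_psubLR. Qed.

Lemma adj_f0 n m : n < 140 -> m < 140 -> adj (f0 n) (f0 m) = gadj n m.
Proof.
move=> hn hm.
have := patP; rewrite /chk_pat => /all_ltP /(_ hn); cbv zeta => /all_ltP /(_ hm) /eqP.
rewrite -/(gadj n m) => ->; rewrite /pat.
have KX t x : t < 12 -> 12 <= x -> x < 140 -> adj (f0 t) (f0 x) = (coord (t %/ 4) (x - 12)./2 == t %% 4).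
  move=> ht hx hx'; rewrite {1}(divn_eq t 4).
  have -> : f0 x = Xc X (x - 12)./2 (odd x).
    by rewrite /f0 !ifF //; apply/negbTE; rewrite -leqNgt (leq_trans _ hx).
  by rewrite adj_KX ?half_lt ?ltn_mod // ltn_divLR.
case: (ltnP n 12) => h; case: (ltnP m 12) => h'.
- exact: adj_KK.
- exact: KX.
- by rewrite adjC; apply: KX.
have fX x : 12 <= x -> f0 x = Xc X (x - 12)./2 (odd x).
  by move=> hx; rewrite /f0 !ifF //; apply/negbTE; rewrite -leqNgt (leq_trans _ hx).
rewrite !fX // (adj_Xc _ _ fr) ?half_lt //; cbv zeta.
by case: eqP => // _; case: eqP => // E; rewrite std ?half_lt.
Qed.

Lemma f0_inj n m : n < 140 -> m < 140 -> f0 n = f0 m -> n = m.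
Proof.
move=> hn hm E; apply/eqP.
have := injP; rewrite /chk_inj => /all_ltP /(_ hn) /all_ltP /(_ hm); case: eqP => // _.
rewrite -adj_f0 // E adjxx lhasE => /hasP [z]; rewrite mem_iota => /= hz.
by rewrite -!adj_f0 // E eqxx.
Qed.

Lemma clq_shape y : y \in Ynames -> exists p q r s, clq y = [:: p; q; r; s] /\
  [/\ [&& p < 140, q < 140, r < 140 & s < 140], is_clique p q r s,
    clique_of (map twin (clq y)),
    all (fun t => sees_one t (clq y) && (t \notin clq y)) (map twin (clq y)) &
    forall n, n < 140 -> ~~ all (gadj n) (clq y)].
Proof.
move=> hy; have := clqP; rewrite /chk_clq lallE => /allP /(_ _ hy).
case/and4P; case: (clq y) => [|p [|q [|r [|s []]]]] // /andP [c1 c2] c3 c4.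
rewrite lallE => /allP c5; exists p, q, r, s; split=> //; split=> // n hn.
by apply: c5; rewrite mem_iota.
Qed.

Lemma fifth_vertex p q r s : adj p q -> adj p r -> adj p s -> adj q r -> adj q s -> adj r s ->
  exists v, [&& adj v p, adj v q, adj v r & adj v s].
Proof.
move=> pq pr ps qr qs rs; have [a [b [ab [a1 a2 a3] [b1 b2 b3] h]]] := tri pq pr qr.
case: (h _ ps qs rs) => E; rewrite E in ps qs rs *.
  by exists b; rewrite ![adj b _]adjC b1 b2 b3 ab.
by exists a; rewrite ![adj a _]adjC a1 a2 a3 adjC.
Qed.

Lemma fY_ex (y : nat) : exists v : V, y \in Ynames -> all (fun p => adj v (f0 p)) (clq y).
Proof.
case: (boolP (y \in Ynames)) => hy; last by exists (f0 0).
have [p [q [r [s [-> [/and4P [hp hq hr hs] cl _ _ _]]]]]] := clq_shape hy.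
move: cl; rewrite /is_clique -!adj_f0 // => /and4P [h1 h2 h3 /and3P [h4 h5 h6]].
have [v /and4P [v1 v2 v3 v4]] := fifth_vertex h1 h2 h3 h4 h5 h6.
by exists v; rewrite /= v1 v2 v3 v4.
Qed.

Definition fY y := sval (constructive_indefinite_description _ (fY_ex y)).
Lemma fYP y : y \in Ynames -> all (fun p => adj (fY y) (f0 p)) (clq y).
Proof. by rewrite /fY; case: constructive_indefinite_description. Qed.

Definition ff n := if n < 140 then f0 n else fY n.

Lemma fY_neq y n : y \in Ynames -> n < 140 -> fY y != f0 n.
Proof.
move=> hy hn; apply/eqP => E; have := fYP hy; rewrite E.
have [p [q [r [s [cE [/and4P [hp hq hr hs] _ _ _ h]]]]]] := clq_shape hy.
by have := h _ hn; rewrite cE /= -!adj_f0 // => /negbTE ->.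
Qed.

Lemma only1_adj v p q r s x : p < 140 -> q < 140 -> r < 140 -> s < 140 ->
  is_clique p q r s -> all (fun p => adj v (f0 p)) [:: p; q; r; s] ->
  x != v -> x \notin map f0 [:: p; q; r; s] ->
  adj x (f0 p) -> ~~ adj x (f0 q) -> ~~ adj x (f0 r) -> ~~ adj x (f0 s) -> adj x v.
Proof.
move=> hp hq hr hs; rewrite /is_clique -!adj_f0 // => /and4P [h1 h2 h3 /and3P [h4 h5 h6]].
case/and5P => vp vq vr vs _ xv; rewrite !inE !negb_or => /and4P [_ nq nr ns] xp xq xr xs.
have c : cl5 (f0 p) (f0 q) (f0 r) (f0 s) v.
  by rewrite /clique5 h1 h2 h3 h4 h5 h6 ![adj _ v]adjC vp vq vr vs.
rewrite adjC in xp; have := gq c xp.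
by rewrite (negPf nq) (negPf nr) (negPf ns) (negPf xv) (negPf xq) (negPf xr) (negPf xs).
Qed.

Lemma perm_clique p q r s : is_clique p q r s -> [&& p < 140, q < 140, r < 140 & s < 140] ->
  [&& is_clique q p r s, is_clique r p q s & is_clique s p q r].
Proof.
move=> cl /and4P [hp hq hr hs]; move: cl; rewrite /is_clique -!adj_f0 //.
by case/and4P => h1 h2 h3 /and3P [h4 h5 h6];
  rewrite ![adj (f0 q) (f0 p)]adjC ![adj (f0 r) (f0 p)]adjC ![adj (f0 s) (f0 p)]adjC
    ![adj (f0 r) (f0 q)]adjC ![adj (f0 s) (f0 q)]adjC ![adj (f0 s) (f0 r)]adjC
    h1 h2 h3 h4 h5 h6.
Qed.

Lemma sees_one_adj v l (x : V) (g : nat -> bool) : clique_of l ->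
  all (fun p => adj v (f0 p)) l -> x != v -> x \notin map f0 l ->
  (forall p, p \in l -> g p = adj x (f0 p)) ->
  (if l is [:: p; q; r; s] then
    [|| [&& g p, ~~ g q, ~~ g r & ~~ g s], [&& g q, ~~ g p, ~~ g r & ~~ g s],
        [&& g r, ~~ g p, ~~ g q & ~~ g s] | [&& g s, ~~ g p, ~~ g q & ~~ g r]] else false) ->
  adj x v.
Proof.
case: l => [|p [|q [|r [|s []]]]] // /andP [lt cl] vl xv xl gE.
have /and3P [cl1 cl2 cl3] := perm_clique cl lt.
rewrite !gE ?inE ?eqxx ?orbT //; move: lt => /and4P [hp hq hr hs].
have /and5P [vp vq vr vs _] := vl.
move: (xl); rewrite !inE !negb_or => /and4P [np nq nr ns].
case/or4P => /and4P [h1 h2 h3 h4].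
- exact: (only1_adj hp hq hr hs cl).
- apply: (only1_adj hq hp hr hs cl1) => //; first by rewrite /= vp vq vr vs.
  by rewrite !inE !negb_or np nq nr ns.
- apply: (only1_adj hr hp hq hs cl2) => //; first by rewrite /= vp vq vr vs.
  by rewrite !inE !negb_or np nq nr ns.
apply: (only1_adj hs hp hq hr cl3) => //; first by rewrite /= vp vq vr vs.
by rewrite !inE !negb_or np nq nr ns.
Qed.

Lemma clique_of_lt l p : clique_of l -> p \in l -> p < 140.
Proof.
case: l => [|a [|b [|c [|d []]]]] // /andP [/and4P [h1 h2 h3 h4] _].
by rewrite !inE => /or4P [] /eqP ->.
Qed.

Lemma name_sees_one v l x : clique_of l -> all (fun p => adj v (f0 p)) l ->
  x < 140 -> f0 x != v -> x \notin l -> sees_one x l -> adj (f0 x) v.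
Proof.
move=> cl vl hx xv xl so; apply: (sees_one_adj (g := gadj x) cl vl xv).
- apply: contra xl => /mapP [p hp /f0_inj E]; rewrite E ?(clique_of_lt cl hp) //.
- by move=> p hp; rewrite adj_f0 // (clique_of_lt cl).
by case: l cl vl xl so => [|p [|q [|r [|s []]]]].
Qed.

(** Every required neighbour lies in one of the two 4-cliques completed by [fY y], or sees exactly
    one vertex of one of them; [gq_axiom] then forces the edge. *)
Lemma edge_YX y x : y \in Ynames -> x < 140 -> gadj y x -> adj (fY y) (f0 x).
Proof.
move=> hy hx yx; have [p [q [r [s [cE [lt cl tcl tso _]]]]]] := clq_shape hy.
have cl0 : clique_of (clq y) by rewrite cE /clique_of lt cl.
have yl := fYP hy.
have yn z : z < 140 -> f0 z != fY y by move=> hz; rewrite eq_sym fY_neq.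
have tl : all (fun p => adj (fY y) (f0 p)) (map twin (clq y)).
  apply/allP => t ht; have /allP /(_ _ ht) /andP [so tn] := tso.
  rewrite adjC; apply: (name_sees_one cl0 yl) => //; first exact: (clique_of_lt tcl).
  by apply: yn; apply: (clique_of_lt tcl).
have := edgeP; rewrite /chk_edge lallE => /allP /(_ _ hy); cbv zeta.
move=> /all_ltP /(_ hx); rewrite yx; case: ifP => [xl _|/negbT xl]; first exact: (allP yl).
case: ifP => [so _|_]; first by rewrite adjC; apply: (name_sees_one cl0 yl) => //; apply: yn.
case: ifP => [xl' _|/negbT xl' so]; first exact: (allP tl).
by rewrite adjC; apply: (name_sees_one tcl tl) => //; apply: yn.
Qed.

Lemma Xnames_lt x : x \in Xnames -> x < 140.
Proof. by rewrite mem_iota => /andP []. Qed.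

(** Exact adjacency with the cells is needed before the counting argument: [edge_YY] has to know
    that [fY y'] sees only one vertex of [clq y]. *)
Lemma adj_YX y x : y \in Ynames -> x \in Xnames -> adj (fY y) (f0 x) = gadj y x.
Proof.
move=> hy hx; have hx' := Xnames_lt hx.
case yx: (gadj y x); first exact: edge_YX.
apply/negP => ayx.
have := nonedgeP; rewrite /chk_nonedge lallE => /allP /(_ _ hy); cbv zeta.
rewrite lallE => /allP /(_ _ hx); rewrite yx lhasE => /hasP [z].
rewrite mem_filter => /andP [yz /Xnames_lt hz]; case: ifP => // _.
rewrite lhasE => /hasP [q]; rewrite mem_filter => /andP [yq /Xnames_lt hq].
case: ifP => // _; case: ifP => // _; case: idx3 => [|s [|t []]] //.
case/and5P => /andP [hs ht] c1 c2 c3 c4.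
have c : cl5 (f0 z) (f0 x) (f0 q) (f0 s) (f0 t).
  by move: c1 c2 c3 c4; rewrite /clique5 !adj_f0 // => -> -> -> ->.
have Yz := edge_YX hy hz yz; have Yq := edge_YX hy hq yq.
have [] : fY y = f0 s \/ fY y = f0 t by apply: (clique5_max adjxx tri c); rewrite adjC.
  by move/eqP; apply/negP/fY_neq.
by move/eqP; apply/negP/fY_neq.
Qed.

Lemma fY_inj y y' : y \in Ynames -> y' \in Ynames -> fY y = fY y' -> y = y'.
Proof.
move=> hy hy' E; apply/eqP; have := distYP; rewrite /chk_distY lallE => /allP /(_ _ hy).
rewrite lallE => /allP /(_ _ hy'); case: eqP => // _; rewrite lhasE => /hasP [x hx].
by rewrite -!adj_YX // E; case: (adj _ _).
Qed.

Lemma clq_Xnames y p : y \in Ynames -> p \in clq y -> p \in Xnames.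
Proof.
move=> hy hp.
have : all (fun y => all (fun p => p \in Xnames) (clq y)) Ynames by vm_compute.
by move=> /allP /(_ _ hy) /allP /(_ _ hp).
Qed.

Lemma edge_YY y y' : y \in Ynames -> y' \in Ynames -> gadj y y' -> adj (fY y') (fY y).
Proof.
move=> hy hy' yy'.
have := YYP; rewrite /chk_YY lallE => /allP /(_ _ hy); rewrite lallE => /allP /(_ _ hy').
rewrite yy' => so; have [p [q [r [s [cE [lt cl _ _ _]]]]]] := clq_shape hy.
have cl0 : clique_of (clq y) by rewrite cE /clique_of lt cl.
have yl := fYP hy; apply: (sees_one_adj (g := gadj y') cl0 yl).
- apply/eqP => /(fY_inj hy' hy) E; move: so; rewrite E.
  have gp t : t \in clq y -> gadj y t.
    by move=> ht; rewrite -adj_YX ?(clq_Xnames hy ht) //; exact: (allP yl).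
  by rewrite cE in gp *; rewrite /sees_one /only1 !gp ?inE ?eqxx ?orbT.
- by apply/mapP => [[p' hp' /eqP]]; apply/negP; apply: fY_neq => //; apply: (clique_of_lt cl0).
- by move=> p' hp'; rewrite adj_YX // (clq_Xnames hy).
by rewrite cE in so *.
Qed.

Lemma gadj_sym n m : n < 176 -> m < 176 -> gadj n m = gadj m n.
Proof.
move=> hn hm; have := degreeP; rewrite /chk_degree => /all_ltP /(_ hn) /andP [_].
by move=> /all_ltP /(_ hm) /eqP.
Qed.

Lemma mem_Ynames n : n < 176 -> 140 <= n -> n \in Ynames.
Proof. by move=> h h'; rewrite mem_iota h'. Qed.

Lemma ff_inj n m : n < 176 -> m < 176 -> ff n = ff m -> n = m.
Proof.
move=> hn hm; rewrite /ff; case: ltnP => hn'; case: ltnP => hm'.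
- exact: f0_inj.
- by move/esym/eqP; rewrite (negPf (fY_neq _ _)) // mem_Ynames.
- by move/eqP; rewrite (negPf (fY_neq _ _)) // mem_Ynames.
by apply: fY_inj; apply: mem_Ynames.
Qed.

Lemma ff_edge n m : n < 176 -> m < 176 -> gadj n m -> adj (ff n) (ff m).
Proof.
move=> hn hm; rewrite /ff; case: ltnP => hn'; case: ltnP => hm'.
- by rewrite adj_f0.
- rewrite gadj_sym // adjC; apply: edge_YX => //; exact: mem_Ynames.
- apply: edge_YX => //; exact: mem_Ynames.
by rewrite gadj_sym //; apply: edge_YY; apply: mem_Ynames.
Qed.

Hypothesis degree40 : forall u, exists2 S : seq V, size S = 40 & forall v, (v \in S) = adj u v.

(** The images of the 40 neighbours of n are distinct and adjacent to [ff n], whose valency is 40,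
    so they are all its neighbours. Hence [ff] also preserves nonadjacency. *)
Lemma ff_closed n v : n < 176 -> adj (ff n) v -> exists m, [/\ m < 176, gadj n m & v = ff m].
Proof.
move=> hn nv; have [S sS SE] := degree40 (ff n).
pose R := [seq ff m | m <- iota 0 176 & gadj n m].
have uR : uniq R.
  rewrite map_inj_in_uniq ?filter_uniq ?iota_uniq // => a b.
  by rewrite !mem_filter !mem_iota => /andP [_ ha] /andP [_ hb]; apply: ff_inj.
have sR : size R = 40.
  rewrite size_map size_filter; apply/eqP.
  by have := degreeP; rewrite /chk_degree => /all_ltP /(_ hn) /andP [].
have RS : {subset R <= S}.
  move=> x /mapP [m]; rewrite mem_filter mem_iota SE => /andP [nm hm] ->.
  exact: ff_edge.
have [_ eqRS] : (size R = size S) * (R =i S).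
  by apply: uniq_min_size => //; rewrite sR sS.
move: nv; rewrite -SE -eqRS => /mapP [m]; rewrite mem_filter mem_iota => /andP [nm hm] ->.
by exists m.
Qed.

Lemma ff_iso n m : n < 176 -> m < 176 -> adj (ff n) (ff m) = gadj n m.
Proof.
move=> hn hm; apply/idP/idP => [h|]; last exact: ff_edge.
by have [m' [hm' nm' /(ff_inj hm hm') ->]] := ff_closed hn h.
Qed.

End Embedding.

Lemma embedding :
  (forall u, exists2 S : seq V, size S = 40 & forall v, (v \in S) = adj u v) ->
  (exists A B L, K444 adj A B L) ->
  exists f : nat -> V, [/\ forall n m, n < 176 -> m < 176 -> f n = f m -> n = m,
    forall n m, n < 176 -> m < 176 -> adj (f n) (f m) = gadj n m &
    forall n v, n < 176 -> adj (f n) v -> exists2 m, m < 176 & v = f m].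
Proof.
move=> deg [A0 [B0 [L0 /standard_frame [A [B [L [X [fr std]]]]]]]].
exists (ff fr std); split.
- exact: ff_inj.
- by move=> n m; apply: ff_iso.
by move=> n v hn /(ff_closed deg hn) [m [hm _ ->]]; exists m.
Qed.

End Frame.

(** * Coordinates *)

Section Coding.
Variables (F : fieldType) (q : nat) (phi : nat -> F).
Hypothesis phi_inj : forall i j, i < q -> j < q -> phi i = phi j -> i = j.
Hypothesis phi_surj : forall x, exists2 i, i < q & phi i = x.
Hypotheses (q_gt1 : 1 < q) (phi0 : phi 0 = 0%R) (phi1 : phi 1 = 1%R).

Definition vec n (l : seq nat) : 'rV[F]_n := (\row_k phi (nth 0 l k))%R.

Definition normn n (l : seq nat) := has (fun i => (nth 0 l i == 1) &&
  all (fun j => nth 0 l j == 0) (iota 0 i)) (iota 0 n).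

Fixpoint wordsq n : seq (seq nat) :=
  if n is m.+1 then [seq x :: w | x <- iota 0 q, w <- wordsq m] else [:: [::]].

Lemma mem_wordsq n l : size l = n -> all (gtn q) l -> l \in wordsq n.
Proof.
elim: n l => [|n IH] [|x l] //= [sl] /andP [hx hl].
by apply/allpairsP; exists (x, l); rewrite mem_iota hx IH.
Qed.

Lemma vec_surj n (v : 'rV[F]_n) : exists l, [/\ size l = n, all (gtn q) l & v = vec n l].
Proof.
pose g x := sval (constructive_indefinite_description _ (let: ex_intro2 i h e := phi_surj x in
  ex_intro (fun i => i < q /\ phi i = x) i (conj h e))).
have gP x : g x < q /\ phi (g x) = x by rewrite /g; case: constructive_indefinite_description.
exists [seq g (v ord0 k) | k <- enum 'I_n]; split.
- by rewrite size_map size_enum_ord.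
- by apply/allP => i /mapP [k _ ->]; case: (gP (v ord0 k)).
apply/rowP => k; rewrite mxE (nth_map k) ?size_enum_ord // nth_ord_enum.
by case: (gP (v ord0 k)).
Qed.

Lemma vec_inj n l l' : size l = n -> size l' = n -> all (gtn q) l -> all (gtn q) l' ->
  vec n l = vec n l' -> l = l'.
Proof.
move=> sl sl' hl hl' /rowP E; apply: (@eq_from_nth _ 0) => [|i hi]; first by rewrite sl sl'.
have hi' : i < n by rewrite -sl.
have := E (Ordinal hi'); rewrite !mxE /=; apply: phi_inj.
  by apply: (allP hl); apply: mem_nth.
by apply: (allP hl'); apply: mem_nth; rewrite sl'.
Qed.

Lemma normalized_vec n l : size l = n -> all (gtn q) l -> normalized (vec n l) = normn n l.
Proof.
move=> sl hl.
have lt i : i < n -> nth 0 l i < q by move=> hi; apply: (allP hl); rewrite mem_nth ?sl.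
have e0 i : i < n -> (phi (nth 0 l i) == 0%R) = (nth 0 l i == 0).
  move=> hi; rewrite -phi0; apply/eqP/eqP => [/phi_inj|->//]; apply; rewrite ?lt //.
  exact: ltnW.
have e1 i : i < n -> (phi (nth 0 l i) == 1%R) = (nth 0 l i == 1).
  by move=> hi; rewrite -phi1; apply/eqP/eqP => [/phi_inj|->//]; apply; rewrite ?lt.
apply/existsP/hasP => [[i /andP []]|[i]].
  rewrite mxE e1 // => h1 /forallP h; exists (i : nat); first by rewrite mem_iota /=.
  rewrite h1; apply/allP => j; rewrite mem_iota /= add0n => hj.
  have hj' := ltn_trans hj (ltn_ord i).
  by have := h (Ordinal hj'); rewrite hj mxE e0.
rewrite mem_iota /= add0n => hi /andP [h1 /allP h]; exists (Ordinal hi).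
rewrite mxE /= e1 // h1; apply/forallP => j; apply/implyP => hj.
by rewrite mxE e0 //; apply: h; rewrite mem_iota.
Qed.

Lemma crd_vec m l k : k <= m -> crd (vec m.+1 l) k = phi (nth 0 l k).
Proof. by move=> hk; rewrite /crd mxE inordK. Qed.

End Coding.

(** * From isomorphisms with the quadrangles to charts *)

Section Charts.
Variables (V : Type) (adj : V -> V -> Prop).

(** A copy of the arbitrary type [V] that carries the classical decision of equality as an
    [eqType]. *)
Definition cV : Type := V.
Definition propb (P : Prop) : bool := if excluded_middle_informative P then true else false.
Lemma propbP P : reflect P (propb P).
Proof. by rewrite /propb; case: excluded_middle_informative => h; constructor. Qed.
HB.instance Definition _ := hasDecEq.Build cV (fun x y => propbP (x = y)).

Definition adjb : rel cV := fun x y => propb (adj x y).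

Lemma chart_of_iso m (F : fieldType) (A2 : 'rV[F]_m -> 'rV[F]_m -> Prop) (S2 : 'rV[F]_m -> Prop)
    (u : V) (T : seq bitseq) (p : nat -> 'rV[F]_m) :
  iso_on adj (adj u) A2 S2 ->
  (forall i, i < 40 -> S2 (p i)) -> (forall v, S2 v -> exists2 i, i < 40 & v = p i) ->
  (forall i j, i < 40 -> j < 40 -> p i = p j -> i = j) ->
  (forall i j, i < 40 -> j < 40 -> A2 (p i) (p j) <-> tadj T i j) ->
  exists e, chart adjb T u e.
Proof.
move=> [f [fS finj fsurj fadj]] Sp Ssurj pinj Ap.
have ex i : exists x : V, i < 40 -> adj u x /\ f x = p i.
  case: (boolP (i < 40)) => hi; last by exists u.
  by have [x ux fx] := fsurj _ (Sp _ hi); exists x.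
pose e i := sval (constructive_indefinite_description _ (ex i)).
have eP i : i < 40 -> adj u (e i) /\ f (e i) = p i.
  by rewrite /e; case: constructive_indefinite_description.
exists e; split.
- by move=> i /eP [h _]; apply/propbP.
- move=> i j hi hj E; apply: pinj => //.
  by have [_ <-] := eP _ hi; have [_ <-] := eP _ hj; rewrite E.
- move=> v /propbP uv; have [i hi vi] := Ssurj _ (fS _ uv); exists i => //.
  by have [ui ei] := eP _ hi; apply: finj => //; rewrite ei.
move=> i j hi hj; have [ui ei] := eP _ hi; have [uj ej] := eP _ hj.
apply/propbP/idP => [h|h].
  by apply/(Ap _ _ hi hj); rewrite -ei -ej; apply/fadj.
by apply/fadj => //; rewrite ei ej; apply/(Ap _ _ hi hj).
Qed.

End Charts.

Section F3.
Definition phi3 (i : nat) : 'F_3 := i%:R%R.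

Lemma phi3_eq0 n : (phi3 n == 0%R) = (n %% 3 == 0).
Proof. by rewrite /phi3 -(dvdn_pcharf (pchar_Fp (isT : prime 3))). Qed.

Lemma val_phi3 i : i < 3 -> val (phi3 i) = i.
Proof. by case: i => [|[|[|[]]]]. Qed.

Lemma phi3_inj i j : i < 3 -> j < 3 -> phi3 i = phi3 j -> i = j.
Proof. by move=> hi hj E; rewrite -(val_phi3 hi) -(val_phi3 hj) E. Qed.

Lemma phi3_surj x : exists2 i, i < 3 & phi3 i = x.
Proof. by exists (val x); [exact: ltn_ord | rewrite /phi3 natr_Zp]. Qed.

Local Notation vecW := (vec phi3 4).
Local Notation vecQ := (vec phi3 5).

(** The factor 2 in [sympn] reaches the field unfolded into repeated addition ending in 0. *)
Lemma neg_F3 (x : 'F_3) : (x + (x + 0) = - x)%R.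
Proof.
have e : (1 + 1 = -1 :> 'F_3)%R by apply/eqP.
by rewrite addr0 -{1 2}[x]mul1r -mulrDl e mulN1r.
Qed.

Lemma symp_vec x y : (symp (vecW x) (vecW y) == 0%R) = (sympn x y == 0).
Proof.
rewrite /symp !crd_vec // /sympn -phi3_eq0 /phi3.
by rewrite !natrD !natrM !neg_F3.
Qed.

Lemma quad_vec x : (quad (vecQ x) == 0%R) = (quadn x == 0).
Proof.
by rewrite /quad !crd_vec // /quadn -phi3_eq0 /phi3 !natrD !natrM expr2.
Qed.

Lemma quadB_vec x y : (quadB (vecQ x) (vecQ y) == 0%R) = (quadBn x y == 0).
Proof.
have crdD (v w : 'rV['F_3]_5) k : crd (v + w)%R k = (crd v k + crd w k)%R by rewrite /crd mxE.
rewrite /quadB /quad !crdD !crd_vec // /quadBn -phi3_eq0 /phi3 !natrD !natrM.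
by congr (_ == _); ring.
Qed.

Definition chk_ptsW := [&& all (fun l => (size l == 4) && all (gtn 3) l) ptsW,
  uniq ptsW, size ptsW == 40, all (normn 4) ptsW &
  all (fun l => normn 4 l ==> (l \in ptsW)) (wordsq 3 4)].
Lemma ptsWP : chk_ptsW. Proof. by vm_cast_no_check isT. Qed.

Definition chk_ptsQ := [&& all (fun l => (size l == 5) && all (gtn 3) l) ptsQ,
  uniq ptsQ, size ptsQ == 40, all (fun l => normn 5 l && (quadn l == 0)) ptsQ &
  all (fun l => normn 5 l && (quadn l == 0) ==> (l \in ptsQ)) (wordsq 3 5)].
Lemma ptsQP : chk_ptsQ. Proof. by vm_cast_no_check isT. Qed.

Lemma nth_table f pts T i j : mktable f pts = T -> i < size pts -> j < size pts ->
  nth false (nth [::] T i) j =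
  (nth [::] pts i != nth [::] pts j) && (f (nth [::] pts i) (nth [::] pts j) == 0).
Proof. by move=> <- hi hj; rewrite (nth_map [::]) // (nth_map [::]). Qed.

Section Points.
Variables (n : nat) (pts : seq (seq nat)).
Hypotheses (sz : all (fun l => (size l == n) && all (gtn 3) l) pts) (un : uniq pts).
Hypothesis sp : size pts = 40.

Lemma pts_vec_inj i j : i < 40 -> j < 40 ->
  vec phi3 n (nth [::] pts i) = vec phi3 n (nth [::] pts j) -> i = j.
Proof.
have h k : k < 40 -> (size (nth [::] pts k) == n) && all (gtn 3) (nth [::] pts k).
  by move=> hk; apply: (allP sz); apply: mem_nth; rewrite sp.
move=> hi hj E; have /andP [/eqP si li] := h _ hi; have /andP [/eqP sj lj] := h _ hj.
by apply/eqP; rewrite -(nth_uniq [::] _ _ un) ?sp //; apply/eqP; apply: (vec_inj phi3_inj si sj).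
Qed.

Lemma tadj_vec (f : seq nat -> seq nat -> nat) T
    (g : 'rV['F_3]_n -> 'rV['F_3]_n -> 'F_3) :
  mktable f pts = T -> (forall x y, (g (vec phi3 n x) (vec phi3 n y) == 0%R) = (f x y == 0)) ->
  forall i j, i < 40 -> j < 40 ->
  (vec phi3 n (nth [::] pts i) <> vec phi3 n (nth [::] pts j) /\
   g (vec phi3 n (nth [::] pts i)) (vec phi3 n (nth [::] pts j)) = 0%R) <-> tadj T i j.
Proof.
move=> TE gf i j hi hj; rewrite /tadj (nth_table TE) ?sp // -gf nth_uniq ?sp //.
split=> [[ne /eqP ->]|/andP [ne /eqP ->]]; last first.
  by split=> // /(pts_vec_inj hi hj) E; rewrite E eqxx in ne.
by rewrite andbT; apply/eqP => E; case: ne; rewrite E.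
Qed.
End Points.

Lemma isW_of_iso (V : Type) (adj : V -> V -> Prop) u :
  iso_on adj (adj u) W3adj W3pt -> isW (@adjb V adj) u.
Proof.
move=> iso; have /and5P [sz un /eqP sp nm co] := ptsWP.
have szP i : i < 40 -> (size (nth [::] ptsW i) == 4) && all (gtn 3) (nth [::] ptsW i).
  by move=> hi; apply: (allP sz); apply: mem_nth; rewrite sp.
apply: (chart_of_iso (p := fun i => vec phi3 4 (nth [::] ptsW i)) iso).
- move=> i hi; have /andP [/eqP si li] := szP _ hi.
  rewrite /W3pt (normalized_vec phi3_inj) //.
  by apply: (allP nm); apply: mem_nth; rewrite sp.
- move=> v; have [l [sl hl ->]] := vec_surj phi3_surj v.
  rewrite /W3pt (normalized_vec phi3_inj) // => nl.
  have /allP /(_ _ (mem_wordsq sl hl)) /implyP /(_ nl) lp := co.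
  by exists (index l ptsW); rewrite ?nth_index // -sp index_mem.
- exact: (pts_vec_inj sz un sp).
exact: (tadj_vec sz un sp TWE symp_vec).
Qed.

Lemma isQ_of_iso (V : Type) (adj : V -> V -> Prop) u :
  iso_on adj (adj u) Q43adj Q43pt -> isQ (@adjb V adj) u.
Proof.
move=> iso; have /and5P [sz un /eqP sp nm co] := ptsQP.
have szP i : i < 40 -> (size (nth [::] ptsQ i) == 5) && all (gtn 3) (nth [::] ptsQ i).
  by move=> hi; apply: (allP sz); apply: mem_nth; rewrite sp.
apply: (chart_of_iso (p := fun i => vec phi3 5 (nth [::] ptsQ i)) iso).
- move=> i hi; have /andP [/eqP si li] := szP _ hi.
  have /andP [n0 q0] : normn 5 (nth [::] ptsQ i) && (quadn (nth [::] ptsQ i) == 0).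
    by apply: (allP nm); apply: mem_nth; rewrite sp.
  by split; [rewrite (normalized_vec phi3_inj) | apply/eqP; rewrite quad_vec].
- move=> v; have [l [sl hl ->]] := vec_surj phi3_surj v.
  rewrite /Q43pt (normalized_vec phi3_inj) // => -[nl /eqP ql]; rewrite quad_vec in ql.
  have /allP /(_ _ (mem_wordsq sl hl)) /implyP := co; rewrite nl ql => /(_ isT) lp.
  by exists (index l ptsQ); rewrite ?nth_index // -sp index_mem.
- exact: (pts_vec_inj sz un sp).
exact: (tadj_vec sz un sp TQE quadB_vec).
Qed.
End F3.

(** * Arithmetic of a field with four elements *)

Section F4.
Variable F : finFieldType.
Hypothesis cF : #|F| = 4.
Local Open Scope ring_scope.

Lemma expF4 (x : F) : x ^+ 4 = x. Proof. by rewrite -cF expf_card. Qed.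

Lemma oppF4 (x : F) : - x = x.
Proof.
have e : (-1 : F) = 1 by rewrite -[LHS]expF4 -signr_odd.
by rewrite -mulN1r e mul1r.
Qed.

Lemma addxx (x : F) : x + x = 0. Proof. by rewrite -{2}[x]oppF4 subrr. Qed.

(** In characteristic 2, x^4 - x is the product of x, x - 1 and x^2 - (x + 1). An element other than
    0 and 1 is a root of the last factor. *)
Lemma exists_gen : exists a : F, a ^+ 2 = a + 1.
Proof.
have [a ha] : exists a : F, a \notin [:: 0; 1].
  apply/existsP; rewrite -negb_forall; apply/negP => /forallP h.
  have : (#|F| <= size [:: 0%R : F; 1%R])%N.
    by rewrite cardE; apply: uniq_leq_size; rewrite ?enum_uniq // => x _; exact: h.
  by rewrite cF.
exists a; move: ha; rewrite !inE negb_or => /andP [a0 a1].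
have : a * (a - 1) * (a ^+ 2 - (a + 1)) == 0.
  have -> : a * (a - 1) * (a ^+ 2 - (a + 1)) =
    a ^+ 4 - a - (a ^+ 3 + a ^+ 3) + (a ^+ 2 - a ^+ 2) + (a + a) by ring.
  by rewrite expF4 !addxx !subrr; apply/eqP; ring.
by rewrite !mulf_eq0 (negPf a0) subr_eq0 (negPf a1) subr_eq0 => /eqP.
Qed.

Section Generator.
Variable a : F.
Hypothesis a2 : a ^+ 2 = a + 1.

Definition phi4 i : F := nth 0 [:: 0; 1; a; a ^+ 2] i.

Lemma gen_cube : a * a ^+ 2 = 1.
Proof. by rewrite a2 mulrDr mulr1 -expr2 a2 addrAC addxx add0r. Qed.

Lemma gen_fourth : a ^+ 2 * a ^+ 2 = a.
Proof. by rewrite -exprD expF4. Qed.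

Lemma phi4_mul i j : (i < 4)%N -> (j < 4)%N -> phi4 (mul4 i j) = phi4 i * phi4 j.
Proof.
by case: i => [|[|[|[|]]]] //; case: j => [|[|[|[|]]]] // _ _;
  rewrite /phi4 /mul4 /= ?(mul0r, mulr0, mul1r, mulr1) //;
  rewrite ?gen_fourth ?gen_cube // mulrC gen_cube.
Qed.

Lemma phi4_add i j : (i < 4)%N -> (j < 4)%N -> phi4 (add4 i j) = phi4 i + phi4 j.
Proof.
have e1 : 1 + a ^+ 2 = a by rewrite a2 addrCA addxx addr0.
have e2 : a + a ^+ 2 = 1 by rewrite a2 addrA addxx add0r.
by case: i => [|[|[|[|]]]] //; case: j => [|[|[|[|]]]] // _ _;
  rewrite /phi4 /add4 /= ?(add0r, addr0, addxx) //;
  rewrite ?e1 ?e2 // addrC ?e1 ?e2.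
Qed.

Lemma uniq_F4 : uniq [:: 0; 1; a; a ^+ 2].
Proof.
have a0 : a != 0 by apply/eqP => E; move: gen_cube; rewrite E mul0r => /esym/eqP; rewrite oner_eq0.
have a1 : a != 1 by apply/eqP => E; move: a2; rewrite E expr1n addxx => /eqP; rewrite oner_eq0.
have b0 : a ^+ 2 != 0 by rewrite expf_eq0.
have b1 : a ^+ 2 != 1 by rewrite a2 -subr_eq0 addrK.
have ba : a ^+ 2 != a by rewrite a2 -subr_eq0 addrAC subrr add0r oner_eq0.
have o : 0 != 1 :> F by rewrite eq_sym oner_eq0.
rewrite eq_sym in a0; rewrite eq_sym in a1; rewrite eq_sym in b0; rewrite eq_sym in b1.
by rewrite eq_sym in ba; rewrite /= !inE !negb_or o a0 b0 a1 b1 ba.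
Qed.

Lemma phi4_inj i j : (i < 4)%N -> (j < 4)%N -> phi4 i = phi4 j -> i = j.
Proof. by move=> hi hj E; apply/eqP; rewrite -(nth_uniq 0 _ _ uniq_F4) //; apply/eqP. Qed.

Lemma phi4_surj x : exists2 i, (i < 4)%N & phi4 i = x.
Proof.
have [_ h] : (size [:: 0; 1; a; a ^+ 2] = size (enum F)) * ([:: 0; 1; a; a ^+ 2] =i enum F).
  apply: uniq_min_size uniq_F4 _ _; first by move=> y _; rewrite mem_enum.
  by rewrite -cardE cF.
have : x \in [:: 0; 1; a; a ^+ 2] by rewrite h mem_enum.
by move=> hx; exists (index x [:: 0; 1; a; a ^+ 2]); rewrite ?index_mem // /phi4 nth_index.
Qed.

Lemma mul4_lt i j : (i < 4)%N -> (j < 4)%N -> (mul4 i j < 4)%N.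
Proof. by case: i => [|[|[|[|]]]] //; case: j => [|[|[|[|]]]]. Qed.

Lemma add4_lt i j : (i < 4)%N -> (j < 4)%N -> (add4 i j < 4)%N.
Proof. by case: i => [|[|[|[|]]]] //; case: j => [|[|[|[|]]]]. Qed.

Lemma hermn_lt x y : all (gtn 4%N) x -> all (gtn 4%N) y -> (hermn x y < 4)%N.
Proof.
elim: x y => [|b x IH] [|c y] //= /andP [hb hx] /andP [hc hy].
by apply: add4_lt; [apply: mul4_lt => //; apply: mul4_lt | apply: IH].
Qed.

Lemma herm_vec n x y : size x = n -> size y = n -> all (gtn 4%N) x -> all (gtn 4%N) y ->
  herm (vec phi4 n x) (vec phi4 n y) = phi4 (hermn x y).
Proof.
rewrite /herm; elim: n x y => [|n IH] [|b x] [|c y] //.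
  by rewrite big_ord0.
move=> [sx] [sy] /= /andP [hb hx] /andP [hc hy].
rewrite big_ord_recl !mxE /= -[hermn _ _]/(add4 (mul4 b (mul4 c c)) (hermn x y)).
have hcc := mul4_lt hc hc; have hbc := mul4_lt hb hcc.
rewrite phi4_add ?hermn_lt // phi4_mul // phi4_mul // -expr2; congr (_ + _).
by rewrite -(IH x y) //; apply: eq_bigr => i _; rewrite !mxE.
Qed.

End Generator.
End F4.

(** * The points of U_5 and the final isomorphism *)

Definition chk_ptsU := [&& all (fun l => (size l == 5) && all (gtn 4) l) ptsU,
  uniq ptsU, size ptsU == 176, all (fun l => normn 5 l && (hermn l l != 0)) ptsU &
  all (fun l => normn 5 l && (hermn l l != 0) ==> (l \in ptsU)) (wordsq 4 5)].
Lemma ptsUP : chk_ptsU. Proof. by vm_cast_no_check isT. Qed.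

Theorem mainTheorem3 (V : Type) (adj : V -> V -> Prop) :
  (forall x y, adj x y -> adj y x) ->
  (forall x, ~ adj x x) ->
  connected_graph adj ->
  (forall u : V, iso_on adj (adj u) W3adj W3pt \/ iso_on adj (adj u) Q43adj Q43pt) ->
  forall (F : finFieldType), #|F| = 4 ->
  iso_on adj (fun _ => True) (@Uadj F 5) (@Upt F 5).
Proof.
move=> sym irr [[v0] conn] loc F cF.
pose a : rel (cV V) := adjb adj.
have aP x y : reflect (adj x y) (a x y) := propbP _.
have aC : symmetric a by move=> x y; apply/aP/aP; apply: sym.
have axx : irreflexive a by move=> x; apply/aP/irr.
have types u : isW a u \/ isQ a u.
  by case: (loc u) => h; [left; exact: isW_of_iso|right; exact: isQ_of_iso].
have reach (P : V -> Prop) x : P x -> (forall y z, adj y z -> P y -> P z) -> forall y, P y.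
  move=> Px step y; elim: (conn x y) Px => // {}x {}y z _ h1 _ h2 /h1; exact: h2.
have allW u : isW a u.
  case: (excluded_middle_informative (exists w, isW a w)) => [[w ww]|no].
    apply: (reach (isW a) w ww) => y z yz; apply: (adj_isW aC axx types); exact/aP.
  case: (not_allQ aC axx types (v0 : cV V)) => w; case: (types w) => // ww.
  by case: no; exists w.
have deg u : exists2 S : seq (cV V), size S = 40 & forall v, (v \in S) = a u v.
  have [e [eu inj surj ad]] := allW u; exists (map e (iota 0 40)).
    by rewrite size_map size_iota.
  move=> v; apply/mapP/idP => [[i]|/surj [i hi ->]].
    by rewrite mem_iota => hi ->; apply: eu.
  by exists i; rewrite ?mem_iota.
have [f [finj fadj fcl]] := embedding aC axx (triangleP types) (gqP types)
  (K44_axiom aC axx allW) (parity_axiomP aC allW) deg (K444_exists aC axx allW v0).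
have fsurj v : exists n, n < 176 /\ v = f n.
  apply: (reach (fun v => exists n, n < 176 /\ v = f n) (f 0)); first by exists 0.
  move=> y z /aP yz [n [hn yE]]; rewrite yE in yz.
  by have [m hm ->] := fcl _ _ hn yz; exists m.
have [g g2] := exists_gen cF.
have pinj := phi4_inj cF g2.
have /and5P [/allP sz un /eqP sp nm co] := ptsUP.
pose p n : 'rV[F]_5 := vec (phi4 g) 5 (nth [::] ptsU n).
have szP n : n < 176 -> size (nth [::] ptsU n) = 5 /\ all (gtn 4) (nth [::] ptsU n).
  move=> hn; have nP : nth [::] ptsU n \in ptsU by rewrite mem_nth ?sp.
  by have /andP [/eqP -> ->] := sz _ nP.
have pp n m : n < 176 -> m < 176 -> p n = p m -> n = m.
  move=> hn hm E; have [s1 l1] := szP _ hn; have [s2 l2] := szP _ hm.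
  by apply/eqP; rewrite -(nth_uniq [::] _ _ un) ?sp //; apply/eqP; apply: (vec_inj pinj s1 s2).
have hE l l' : size l = 5 -> size l' = 5 -> all (gtn 4) l -> all (gtn 4) l' ->
    (herm (vec (phi4 g) 5 l) (vec (phi4 g) 5 l') == 0%R) = (hermn l l' == 0).
  move=> s1 s2 l1 l2; rewrite herm_vec //.
  apply/eqP/eqP => [h|-> //]; apply: pinj; rewrite ?hermn_lt //.
pose idx v := sval (constructive_indefinite_description _ (fsurj v)).
have idxP v : idx v < 176 /\ v = f (idx v).
  by rewrite /idx; case: constructive_indefinite_description.
exists (fun v => p (idx v)); split.
- move=> x _; have [hx _] := idxP x; have [s1 l1] := szP _ hx.
  have /andP [n0 h0] : normn 5 (nth [::] ptsU (idx x)) &&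
      (hermn (nth [::] ptsU (idx x)) (nth [::] ptsU (idx x)) != 0).
    by apply: (allP nm); apply: mem_nth; rewrite sp.
  by split; [rewrite (normalized_vec pinj) | rewrite hE].
- move=> x y _ _; have [hx {2}->] := idxP x; have [hy {2}->] := idxP y.
  by move=> /(pp _ _ hx hy) ->.
- move=> y; have [l [sl hl ->]] := vec_surj (phi4_surj cF g2) y.
  rewrite /Upt (normalized_vec pinj) // hE // => nl.
  have /allP /(_ _ (mem_wordsq sl hl)) /implyP := co.
  have -> : normn 5 l && (hermn l l != 0) by apply/andP.
  move=> /(_ isT) lp; have hi : index l ptsU < 176 by rewrite -sp index_mem.
  exists (f (index l ptsU)) => //; have [h1 h2] := idxP (f (index l ptsU)).
  by rewrite /p -(finj _ _ hi h1 h2) nth_index.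
move=> x y _ _; have [hx xE] := idxP x; have [hy yE] := idxP y.
have [s1 l1] := szP _ hx; have [s2 l2] := szP _ hy.
have -> : adj x y <-> gadj (idx x) (idx y).
  by rewrite -fadj // -xE -yE; split=> /aP.
rewrite /gadj (nth_table GUE) ?sp // -hE // nth_uniq ?sp // /Uadj.
split=> [/andP [ne /eqP h]|[ne h]]; first by split=> // /(pp _ _ hx hy) E; rewrite E eqxx in ne.
by rewrite h eqxx andbT; apply/eqP => E; case: ne; rewrite E.
Qed.
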